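(* Let $n\ge1$ and let $\alpha$, $\beta$, $\gamma$ be weakly decreasing sequences of $n$ real numbers. There exist real symmetric $n\times n$ matrices $A$, $B$, $C$ with $C=A+B$ and with eigenvalues (listed with multiplicity) $\alpha$, $\beta$, $\gamma$ respectively, if and only if there exist complex Hermitian $n\times n$ matrices $A'$, $B'$, $C'$ with $C'=A'+B'$ and with eigenvalues $\alpha$, $\beta$, $\gamma$ respectively.
   Context: Eigenvalues of a real symmetric or complex Hermitian matrix are real and are listed in weakly decreasing order, each repeated according to its multiplicity. *)

(* Defs.v *)
From HB Require Import structures.
From mathcomp Require Import all_boot all_order all_algebra.
From mathcomp Require Import reals.
From mathcomp Require Import complex.

Set Implicit Arguments.
Unset Strict Implicit.
Unset Printing Implicit Defensive.

Import Order.TTheory GRing.Theory Num.Theory.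
Local Open Scope ring_scope.

(* [s] lists the eigenvalues of [M] with algebraic multiplicity, in any order;
   the decreasing order is imposed separately by [sorted >=%R s]. *)
Definition eigenvalue_list (F : fieldType) (n : nat) (M : 'M[F]_n) (s : seq F) : Prop :=
  char_poly M = \prod_(x <- s) ('X - x%:P).

(* Main.v *)
Require Import Defs.
From HB Require Import structures.
From mathcomp Require Import all_boot all_order all_algebra.
From mathcomp Require Import reals.
From mathcomp Require Import perm.
From mathcomp Require Import closed_field complex.
From mathcomp Require Import boolp classical_sets topology normedtype sequences exp.
From mathcomp Require Import lra ring.

(** Complexifying a real solution gives a Hermitian one. Conversely, write the
    Hermitian solution as a family of unitary matrices [U i] and decreasing
    spectra [w i], for [A], [B] and [- C], such that the matrices
    [(U i)^t* *m rdiag (w i) *m U i] sum to 0; what is needed is a family of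
    real symmetric matrices with the same spectra and sum 0
    ([hermitian_to_real]).

    A Hermitian matrix with spectrum [w] is a complete flag, the leading row
    spaces of an invertible matrix [X], with weights [w k - w k.+1] on its
    members ([flagmx X w]). The group of invertible matrices [g] acts on the
    families of flags given by [X i *m g], and the sum of the matrices
    [flagmx (X i *m g) (w i)], the moment at [g], is up to a factor the gradient
    of the Kempf-Ness function, a weighted sum of logarithms of Gram
    determinants. That function is convex along one-parameter subgroups
    ([kn_tangent]). A family of flags is semistable when this function has a
    nonnegative slope at infinity along every one-parameter subgroup. The slopes
    depend only on which entries vanish in matrices built from the [X i], so
    this is an algebraic property of the flags.

    Semistable families of real flags solve the problem. By convexity and
    compactness the Kempf-Ness function of a semistable family decreases at most
    sublinearly ([semistable_coercive]), so that with a small multiple of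
    a logarithmic norm added it has almost minimal points among the real [g]. At
    such a point the moment is a real symmetric matrix, gradient descent does not
    leave the real matrices, and therefore the moment is small
    ([semistable_near_balanced]). The corresponding real weighted flags have
    a convergent subsequence, and their limits have sum 0
    ([semistable_real_balanced]).

    It remains to find a semistable family of real flags. Consider the pencil
    [X z i = Re (U i) + z Im (U i)], which is real for real [z] and gives the
    Hermitian solution at [z = 'i]. A one-parameter subgroup of negative slope
    has one of finitely many shapes, and the parameters [z] at which a given
    shape occurs are finite or cofinite in number, by elimination of quantifiers
    ([destabilisation_generic]). A shape of negative slope cannot occur for
    cofinitely many [z]: it would occur arbitrarily close to ['i], where the
    moment tends to 0, while by convexity the size of the moment bounds the
    slope from below ([slope_ge_moment]). So all but finitely many [z], and in
    particular some integer, give a semistable family. *)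

Set Implicit Arguments.
Unset Strict Implicit.
Unset Printing Implicit Defensive.

Import Order.TTheory GRing.Theory Num.Theory.
Import numFieldNormedType.Exports.
Local Open Scope ring_scope.
Local Open Scope sesquilinear_scope.
Local Notation conjC := Num.Def.conjC.

(** * Complex numbers over a real type *)

(** The numerically closed field [R[i]], with [R[i]] itself hidden, so that the
    ring structures of matrix entries are always inferred from this one. *)
Definition cplx (R : realType) : numClosedFieldType := R[i]%C.

Section ComplexNumbers.
Context {R : realType}.
Local Notation C := (cplx R).

Definition toC (x : R) : C := real_complex R x.
Definition re (z : C) : R := complex.Re (z : R[i]%C).

Lemma toC_is_zmod_morphism : zmod_morphism toC.
Proof. exact: (rmorphB (real_complex R)). Qed.

Lemma toC_is_monoid_morphism : monoid_morphism toC.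
Proof. by split; [exact: rmorph1|exact: (rmorphM (real_complex R))]. Qed.

HB.instance Definition _ := GRing.isZmodMorphism.Build R C toC
  toC_is_zmod_morphism.
HB.instance Definition _ := GRing.isMonoidMorphism.Build R C toC
  toC_is_monoid_morphism.

Lemma re_is_zmod_morphism : zmod_morphism re.
Proof. by move=> [a b] [c d]. Qed.

HB.instance Definition _ := GRing.isZmodMorphism.Build C R re
  re_is_zmod_morphism.

Lemma toC_re z : toC (re z) = 'Re z.
Proof. exact: (complexRe (z : R[i]%C)). Qed.

Lemma re_toC x : re (toC x) = x. Proof. by []. Qed.

Lemma toC_inj : injective toC.
Proof. by move=> x y /(congr1 re); rewrite !re_toC. Qed.

Lemma toC_real x : toC x \is Num.real.
Proof. by rewrite -[x]re_toC toC_re Creal_Re. Qed.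

Lemma conj_toC x : (toC x)^* = toC x.
Proof. by apply/CrealP; exact: toC_real. Qed.

Lemma toC_re_real z : z \is Num.real -> toC (re z) = z.
Proof. by move=> zr; rewrite toC_re; apply/Creal_ReP. Qed.

Lemma re_conj z : re z^* = re z.
Proof. by apply: toC_inj; rewrite !toC_re Re_conj. Qed.

Lemma re_sum (I : Type) (r : seq I) (P : pred I) (F : I -> C) :
  re (\sum_(i <- r | P i) F i) = \sum_(i <- r | P i) re (F i).
Proof. exact: raddf_sum. Qed.

Lemma reZ (a : R) (x : C) : re (toC a * x) = a * re x.
Proof. by case: x => [b c]; rewrite /re /= mul0r subr0. Qed.

Definition im (z : C) : R := re (- 'i * z).

Lemma toC_im z : toC (im z) = 'Im z.
Proof. by rewrite /im toC_re mulNr raddfN /= ReMil opprK. Qed.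

(** The square of the modulus. *)
Definition sqn (z : C) : R := re z ^+ 2 + im z ^+ 2.

Lemma mul_conj_sqn (z : C) : z * z^* = toC (sqn z).
Proof.
rewrite rmorphD !rmorphXn /= toC_re toC_im -normCK.
by rewrite {1}[z]Crect normC2_rect ?Creal_Re ?Creal_Im.
Qed.

Lemma sqn_ge0 z : 0 <= sqn z.
Proof. by rewrite addr_ge0 ?sqr_ge0. Qed.

Lemma sqn_eq0 z : (sqn z == 0) = (z == 0).
Proof.
rewrite -(inj_eq toC_inj) -mul_conj_sqn rmorph0 mulf_eq0 conjC_eq0.
by rewrite orbb.
Qed.

Lemma sqn_gt0 z : (0 < sqn z) = (z != 0).
Proof. by rewrite lt_neqAle sqn_ge0 andbT eq_sym sqn_eq0. Qed.

Lemma sqnM z1 z2 : sqn (z1 * z2) = sqn z1 * sqn z2.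
Proof.
apply: toC_inj; rewrite rmorphM /= -!mul_conj_sqn rmorphM /=.
by rewrite mulrACA.
Qed.

Lemma sqn_real (x : R) : sqn (toC x) = x ^+ 2.
Proof.
by apply: toC_inj; rewrite -mul_conj_sqn conj_toC rmorphXn expr2.
Qed.

Lemma sqn1 : sqn 1 = 1.
Proof. by apply: toC_inj; rewrite -mul_conj_sqn !rmorph1 mulr1. Qed.

End ComplexNumbers.

Opaque cplx.

(** * Hermitian and unitary matrices, and two determinant inequalities *)

Section LinearAlgebra.
Context {R : realType}.
Local Notation C := (cplx R).

Definition rdiag n (f : 'I_n -> R) : 'M[C]_n := diag_mx (\row_i (toC (f i))).

Lemma eq_rdiag n (f g : 'I_n -> R) : f =1 g -> rdiag f = rdiag g.
Proof. by move=> e; congr diag_mx; apply/rowP => i; rewrite !mxE e. Qed.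

Lemma rdiagM n (f g : 'I_n -> R) :
  rdiag f *m rdiag g = rdiag (fun i => f i * g i).
Proof.
rewrite /rdiag mulmx_diag; congr diag_mx; apply/rowP => i.
by rewrite !mxE rmorphM.
Qed.

Lemma rdiag1 n : rdiag (fun=> 1) = 1%:M :> 'M_n.
Proof.
by apply/matrixP => i j; rewrite !mxE; case: eqP.
Qed.

Lemma rdiagZ n a (f : 'I_n -> R) : rdiag (fun i => a * f i) = (toC a) *: rdiag f.
Proof. by apply/matrixP => i j; rewrite !mxE rmorphM mulrnAr. Qed.

Lemma rdiag_unit n (f : 'I_n -> R) :
  (forall i, f i != 0) -> rdiag f \in unitmx.
Proof.
move=> f0; rewrite unitmxE det_diag unitfE; apply/prodf_neq0 => i _.
by rewrite mxE fmorph_eq0.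
Qed.

Lemma det_rdiag n (f : 'I_n -> R) : \det (rdiag f) = (toC (\prod_i f i)).
Proof. by rewrite det_diag rmorph_prod; apply: eq_bigr => i _; rewrite mxE. Qed.

Lemma adjmxM m n p (A : 'M[C]_(m, n)) (B : 'M[C]_(n, p)) :
  (A *m B)^t* = B^t* *m A^t*.
Proof. by rewrite trmx_mul map_mxM. Qed.

Lemma adjmxK m n (A : 'M[C]_(m, n)) : A^t*^t* = A.
Proof. exact: trmxCK. Qed.

Lemma adjmxD m n (A B : 'M[C]_(m, n)) : (A + B)^t* = A^t* + B^t*.
Proof. by rewrite linearD /= map_mxD. Qed.

Lemma adjmx1 n : (1%:M : 'M[C]_n)^t* = 1%:M.
Proof. by rewrite trmx1 map_mx1. Qed.

Lemma adj_rdiag n (f : 'I_n -> R) : (rdiag f)^t* = rdiag f.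
Proof.
rewrite /rdiag tr_diag_mx map_diag_mx; congr diag_mx; apply/rowP => i.
by rewrite !mxE /= conj_toC.
Qed.

Lemma det_adj n (A : 'M[C]_n) : \det (A^t*) = (\det A)^*.
Proof. by rewrite det_map_mx det_tr. Qed.

Lemma adj_inv n (A : 'M[C]_n) : (invmx A)^t* = invmx (A^t*).
Proof. by rewrite trmx_inv map_invmx. Qed.

Lemma adj_unit n (A : 'M[C]_n) : (A^t* \in unitmx) = (A \in unitmx).
Proof. by rewrite map_unitmx unitmx_tr. Qed.

Lemma unitary_adjK n (U : 'M[C]_n) : U \is unitarymx -> U^t* *m U = 1%:M.
Proof. by move=> /unitarymxP /mulmx1C. Qed.

Lemma adj_unitary n (U : 'M[C]_n) : U \is unitarymx -> U^t* \is unitarymx.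
Proof. by move=> Uu; apply/unitarymxP; rewrite adjmxK unitary_adjK. Qed.

Lemma congr_rdiagE m n (K : 'M[C]_(m, n)) (f : 'I_n -> R) i :
  (K *m rdiag f *m K^t*) i i = (toC (\sum_j sqn (K i j) * f j)).
Proof.
rewrite mxE rmorph_sum; apply: eq_bigr => j _ /=.
by rewrite mul_mx_diag !mxE rmorphM /= -mul_conj_sqn mulrAC.
Qed.

Lemma mul_adj_diagE m n (K : 'M[C]_(m, n)) i :
  (K *m K^t*) i i = (toC (\sum_j sqn (K i j))).
Proof.
rewrite -[K in K *m _]mulmx1 -rdiag1 congr_rdiagE; congr ((toC _)).
by apply: eq_bigr => j _; rewrite mulr1.
Qed.

Lemma tr_mul_adj m n (K : 'M[C]_(m, n)) :
  \tr (K *m K^t*) = (toC (\sum_i \sum_j sqn (K i j))).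
Proof.
by rewrite rmorph_sum; apply: eq_bigr => i _; rewrite mul_adj_diagE.
Qed.

Lemma hermitian_diag n (H : 'M[C]_n) : H^t* = H ->
  exists U (d : 'I_n -> R), U \is unitarymx /\ H = U^t* *m rdiag d *m U.
Proof.
move=> Hh; have Hs : H \is hermsymmx.
  by apply/is_hermitianmxP; rewrite expr0 scale1r Hh.
have /orthomx_spectralP eH := hermitian_normalmx Hs.
exists (spectralmx H), (fun i => re (spectral_diag H 0 i)).
split; first exact: spectral_unitarymx.
apply: (etrans eH); congr (_ *m _ *m _).
  exact: (invmx_unitary (spectral_unitarymx H)).
congr diag_mx; apply/rowP => i; rewrite mxE.
have /mxOverP/(_ 0 i) := hermitian_spectral_diag_real Hs.
by move=> /toC_re_real ->.
Qed.

Lemma unitary_congr_eq n (U H D : 'M[C]_n) : U \is unitarymx ->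
  H = U^t* *m D *m U -> U *m H *m U^t* = D.
Proof.
move=> Uu ->; rewrite !mulmxA (unitarymxP Uu) mul1mx.
by rewrite -mulmxA (unitarymxP Uu) mulmx1.
Qed.

Lemma det_unitary_congr n (U D : 'M[C]_n) : U \is unitarymx ->
  \det (U^t* *m D *m U) = \det D.
Proof.
move=> Uu; rewrite !det_mulmx mulrAC -det_mulmx unitary_adjK //.
by rewrite det1 mul1r.
Qed.

Lemma unitary_row_sqn m n (Q : 'M[C]_(m, n)) i :
  Q \is unitarymx -> \sum_j sqn (Q i j) = 1.
Proof.
move=> /unitarymxP QQ; apply: toC_inj.
by rewrite -mul_adj_diagE QQ mxE eqxx.
Qed.

(** AM-GM for the eigenvalues of a Gram matrix. *)
Lemma det_gram_le_expR m n (K : 'M[C]_(m, n)) :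
  re (\det (K *m K^t*)) <= expR (\sum_i \sum_j sqn (K i j) - m%:R).
Proof.
have Hh : (K *m K^t*)^t* = K *m K^t* by rewrite adjmxM adjmxK.
have [U [d [Uu eH]]] := hermitian_diag Hh.
have dE i : d i = \sum_j sqn ((U *m K) i j).
  have := unitary_congr_eq Uu eH; rewrite !mulmxA -mulmxA -adjmxM.
  move=> /matrixP/(_ i i); rewrite mul_adj_diagE !mxE eqxx mulr1n.
  by move=> /toC_inj.
have -> : \sum_i \sum_j sqn (K i j) = \sum_i d i.
  apply: toC_inj; rewrite -tr_mul_adj eH mxtrace_mulC mulmxA.
  rewrite (unitarymxP Uu) mul1mx mxtrace_diag rmorph_sum.
  by apply: eq_bigr => i _; rewrite mxE.
rewrite eH det_unitary_congr // det_rdiag /=.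
have -> : \sum_i d i - m%:R = \sum_i (d i - 1).
  by rewrite sumrB sumr_const card_ord.
rewrite expR_sum; apply: ler_prod => i _; apply/andP; split.
  by rewrite dE sumr_ge0 // => j _; exact: sqn_ge0.
by rewrite (le_trans _ (expR_ge1Dx _)) // addrC subrK.
Qed.

(** Jensen's inequality for the exponential: sum the supporting lines at the
    mean. *)
Lemma expR_convex_sum n (p x : 'I_n -> R) :
  (forall j, 0 <= p j) -> \sum_j p j = 1 ->
  expR (\sum_j p j * x j) <= \sum_j p j * expR (x j).
Proof.
move=> p0 p1; set m := \sum_j _ * x _.
have -> : expR m = \sum_j p j * (expR m * (1 + (x j - m))).
  rewrite (eq_bigr (fun j => expR m * ((1 - m) * p j + p j * x j))); last first.
    by move=> j _; ring.
  by rewrite -mulr_sumr big_split /= -mulr_sumr p1 -/m; ring.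
apply: ler_sum => j _; apply: ler_wpM2l; first exact: p0.
rewrite -[leRHS](_ : expR m * expR (x j - m) = _).
  by rewrite ler_wpM2l ?expR_ge0 // expR_ge1Dx.
by rewrite -expRD addrC subrK.
Qed.

(** Jensen's inequality, applied in an orthonormal basis of the row space of
    [Q] that diagonalises the compression of the diagonal matrix. *)
Lemma expR_le_det_compression m n (Q : 'M[C]_(m, n)) (l : 'I_n -> R) :
  Q \is unitarymx ->
  expR (\sum_i \sum_j sqn (Q i j) * l j)
    <= re (\det (Q *m rdiag (fun j => expR (l j)) *m Q^t*)).
Proof.
move=> Qu; set E := rdiag _; set M := Q *m E *m Q^t*.
have Mh : M^t* = M by rewrite /M !adjmxM adjmxK adj_rdiag mulmxA.
have [U [d [Uu eM]]] := hermitian_diag Mh.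
have UQu : U *m Q \is unitarymx by apply: mul_unitarymx.
have dE i : d i = \sum_j sqn ((U *m Q) i j) * expR (l j).
  have := unitary_congr_eq Uu eM.
  rewrite /M !mulmxA -[_ *m Q^t* *m _]mulmxA -adjmxM.
  move=> /matrixP/(_ i i); rewrite congr_rdiagE !mxE eqxx mulr1n.
  by move=> /toC_inj.
have -> : \sum_i \sum_j sqn (Q i j) * l j =
          \sum_i \sum_j sqn ((U *m Q) i j) * l j.
  have trE (K : 'M[C]_(m, n)) :
      (toC (\sum_i \sum_j sqn (K i j) * l j)) = \tr (K *m rdiag l *m K^t*).
    rewrite rmorph_sum; apply: eq_bigr => i _ /=.
    by rewrite congr_rdiagE.
  apply: toC_inj; rewrite !trE adjmxM -!mulmxA [RHS]mxtrace_mulC -!mulmxA.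
  by rewrite (unitary_adjK Uu) mulmx1.
rewrite eM det_unitary_congr // det_rdiag /= expR_sum.
apply: ler_prod => i _; rewrite expR_ge0 /= dE.
apply: expR_convex_sum => [j|]; first exact: sqn_ge0.
exact: unitary_row_sqn.
Qed.

End LinearAlgebra.

(** * Gram determinants and orthogonal projections *)

Section GramDeterminants.
Context {R : realType}.
Local Notation C := (cplx R).

(** The squared volume spanned by the rows; it is a nonnegative real number. *)
Definition gramdet m n (Y : 'M[C]_(m, n)) : R := re (\det (Y *m Y^t*)).

(** For independent rows, the orthogonal projection of row vectors onto the
    row space; it depends on the row space only. *)
Definition rowproj m n (Y : 'M[C]_(m, n)) : 'M[C]_n :=
  Y^t* *m invmx (Y *m Y^t*) *m Y.

Lemma row_free_decomp m n (Y : 'M[C]_(m, n)) : row_free Y ->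
  exists T Q, [/\ T \in unitmx, Q \is unitarymx & Y = T *m Q].
Proof.
move=> Yf; have lemn : (m <= n)%N by rewrite -(eqP Yf) rank_leq_col.
have /submxP[T eY] := schmidt_sub Y.
exists T, (schmidt Y); split => //; last exact: schmidt_unitarymx.
rewrite -row_free_unit /row_free eqn_leq rank_leq_row /=.
by rewrite -[leqLHS](eqP Yf) {1}eY mxrankM_maxl.
Qed.

Lemma gramdetMl m n (T : 'M[C]_m) (Y : 'M[C]_(m, n)) :
  gramdet (T *m Y) = sqn (\det T) * gramdet Y.
Proof.
rewrite /gramdet adjmxM !mulmxA -[T *m Y *m _]mulmxA !det_mulmx det_adj.
by rewrite mulrAC mul_conj_sqn reZ.
Qed.

Lemma gramdet_unitary m n (Q : 'M[C]_(m, n)) :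
  Q \is unitarymx -> gramdet Q = 1.
Proof. by move=> Qu; rewrite /gramdet (unitarymxP Qu) det1. Qed.

Lemma gramdet_gt0 m n (Y : 'M[C]_(m, n)) : row_free Y -> 0 < gramdet Y.
Proof.
move=> /row_free_decomp[T [Q [Tu Qu ->]]].
rewrite gramdetMl gramdet_unitary // mulr1 sqn_gt0.
by rewrite unitmxE unitfE in Tu.
Qed.

Lemma gramdet_square n (Y : 'M[C]_n) : gramdet Y = sqn (\det Y).
Proof. by rewrite -[Y]mulmx1 gramdetMl gramdet_unitary ?mulr1 ?mulmx1 //;
  apply/unitarymxP; rewrite adjmx1 mulmx1. Qed.

Lemma rowproj_unitary m n (T : 'M[C]_m) (Q : 'M[C]_(m, n)) :
  T \in unitmx -> Q \is unitarymx -> rowproj (T *m Q) = Q^t* *m Q.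
Proof.
move=> Tu Qu; rewrite /rowproj adjmxM !mulmxA -[T *m Q *m _]mulmxA.
rewrite (unitarymxP Qu) mulmx1.
have Gu : T *m T^t* \in unitmx by rewrite unitmx_mul Tu adj_unit.
have -> : invmx (T *m T^t*) = invmx (T^t*) *m invmx T.
  apply: (can_inj (mulKmx Gu)); rewrite mulmxV // !mulmxA.
  by rewrite mulmxK ?mulmxV // adj_unit.
rewrite !mulmxA mulmxK ?adj_unit // -!mulmxA; congr (_ *m _).
by rewrite mulKmx.
Qed.

Lemma rowproj_mulr_unitary m n (Y : 'M[C]_(m, n)) (U : 'M[C]_n) :
  U \is unitarymx -> rowproj (Y *m U) = U^t* *m rowproj Y *m U.
Proof.
move=> Uu; rewrite /rowproj adjmxM.
rewrite (mulmxA (Y *m U)) -(mulmxA Y U) (unitarymxP Uu) mulmx1.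
by rewrite !mulmxA.
Qed.

Lemma rowproj_conj m n (Y : 'M[C]_(m, n)) :
  rowproj (map_mx conjC Y) = map_mx conjC (rowproj Y).
Proof. by rewrite /rowproj !map_mxM map_invmx map_mxM !map_trmx. Qed.

(** The first-order expansion of the volume at [h = 1], as an upper bound: once
    the rows are orthonormal, this is AM-GM for the Gram matrix. *)
Lemma gramdet_mulr_le m n (Y : 'M[C]_(m, n)) (h : 'M[C]_n) : row_free Y ->
  gramdet (Y *m h)
    <= gramdet Y * expR (re (\tr (rowproj Y *m (h *m h^t* - 1%:M)))).
Proof.
move=> /row_free_decomp[T [Q [Tu Qu ->]]].
rewrite -(mulmxA T) !gramdetMl (gramdet_unitary Qu) mulr1.
rewrite ler_wpM2l ?sqn_ge0 // rowproj_unitary //.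
apply: (le_trans (det_gram_le_expR _)); rewrite ler_expR.
have -> : re (\tr (Q^t* *m Q *m (h *m h^t* - 1%:M)))
    = re (\tr ((Q *m h) *m (Q *m h)^t*) - \tr (Q *m Q^t*)).
  rewrite mulmxBr mulmx1 raddfB /=; congr (re (_ - _)).
    by rewrite adjmxM -!mulmxA mxtrace_mulC -!mulmxA.
  by rewrite mxtrace_mulC.
by rewrite (unitarymxP Qu) mxtrace1 tr_mul_adj -(rmorph_nat toC) -rmorphB.
Qed.

(** The matching lower bound, exact to first order, for diagonal [h]: once the
    rows are orthonormal, this is Jensen's inequality. It is the source of all
    convexity below. *)
Lemma gramdet_expR_ge m n (Y : 'M[C]_(m, n)) (l : 'I_n -> R) : row_free Y ->
  gramdet Y * expR (2 * re (\tr (rowproj Y *m rdiag l)))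
    <= gramdet (Y *m rdiag (fun j => expR (l j))).
Proof.
move=> /row_free_decomp[T [Q [Tu Qu ->]]].
rewrite -(mulmxA T) !gramdetMl (gramdet_unitary Qu) mulr1.
rewrite ler_wpM2l ?sqn_ge0 // rowproj_unitary //.
rewrite /gramdet adjmxM adj_rdiag mulmxA -[Q *m _ *m _]mulmxA rdiagM.
have -> : rdiag (fun i => expR (l i) * expR (l i)) =
          rdiag (fun i => expR (2 * l i)).
  by apply: eq_rdiag => i; rewrite -expRD mulr_natl mulr2n.
apply: le_trans (expR_le_det_compression _ Qu); rewrite ler_expR.
rewrite -mulmxA mxtrace_mulC -(mulmxA Q).
have -> : Q *m (rdiag l *m Q^t*) = Q *m rdiag l *m Q^t* by rewrite mulmxA.
rewrite /mxtrace re_sum mulr_sumr; apply: ler_sum => i _.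
rewrite congr_rdiagE /= mulr_sumr; apply: ler_sum => j _.
by rewrite mulrCA.
Qed.

(** Once the rows are orthonormal, a square submatrix is a contraction. *)
Lemma minor_le_gramdet m n (Y : 'M[C]_(m, n)) (f : 'I_m -> 'I_n) :
  injective f -> row_free Y -> sqn (\det (colsub f Y)) <= gramdet Y.
Proof.
move=> fI /row_free_decomp[T [Q [Tu Qu ->]]].
rewrite gramdetMl (gramdet_unitary Qu) mulr1 -mulmx_colsub det_mulmx sqnM.
rewrite ler_piMr ?sqn_ge0 // -gramdet_square.
apply: (le_trans (det_gram_le_expR _)); rewrite -[leRHS]expR0 ler_expR subr_le0.
have -> : m%:R = \sum_(i < m) 1 :> R by rewrite sumr_const card_ord.
apply: ler_sum => i _; rewrite -(unitary_row_sqn i Qu).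
under eq_bigr do rewrite mxE.
rewrite -(big_map f xpredT (fun j => sqn (Q i j))) /=.
rewrite [leLHS](_ : _ = \sum_(j in [set f x | x : 'I_m]) sqn (Q i j)).
  rewrite [leRHS](bigID (mem [set f x | x : 'I_m])) /= lerDl sumr_ge0 //.
  by move=> *; exact: sqn_ge0.
by rewrite big_imset /= ?big_map ?big_filter //; move=> ? ? _ _; exact: fI.
Qed.

End GramDeterminants.

(** * Weighted flags *)

Section Flags.
Context {R : realType}.
Local Notation C := (cplx R).

(** Indexing by ['I_n] leaves out the zero subspace and keeps the whole space. *)
Definition top n p (k : 'I_n) (A : 'M[C]_(n, p)) : 'M[C]_(k.+1, p) :=
  rowsub (widen_ord (ltn_ord k)) A.

Lemma top_mulmx n p q k (A : 'M[C]_(n, p)) (B : 'M[C]_(p, q)) :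
  top k (A *m B) = top k A *m B.
Proof. by rewrite /top mul_rowsub_mx. Qed.

Lemma top_trig n p k (T : 'M[C]_n) (B : 'M[C]_(n, p)) : is_trig_mx T ->
  top k (T *m B) =
    mxsub (widen_ord (ltn_ord k)) (widen_ord (ltn_ord k)) T *m top k B.
Proof.
move=> /is_trig_mxP Tt; apply/matrixP => i j; rewrite !mxE.
rewrite (bigID (fun x : 'I_n => (x < k.+1)%N)) /= [X in _ + X]big1 => [|x].
  rewrite addr0 (big_ord_narrow (ltn_ord k)) /=.
  by apply: eq_bigr => x _; rewrite !mxE.
by rewrite -leqNgt => kx; rewrite Tt ?mul0r //= (leq_ltn_trans _ kx) // -ltnS.
Qed.

Lemma det_mxsub_trig n k (T : 'M[C]_n) : is_trig_mx T ->
  \det (mxsub (widen_ord (ltn_ord k)) (widen_ord (ltn_ord k)) T)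
    = \prod_(i < n | (i <= k)%N) T i i.
Proof.
move=> /is_trig_mxP Tt; rewrite det_trig.
  rewrite (eq_bigl (fun i : 'I_n => (i < k.+1)%N)) //.
  rewrite (big_ord_narrow (ltn_ord k)) /=.
  by apply: eq_bigr => i _; rewrite !mxE.
by apply/is_trig_mxP => i j ij; rewrite mxE Tt.
Qed.

Lemma trig_unit n (T : 'M[C]_n) : is_trig_mx T ->
  (T \in unitmx) = [forall i, T i i != 0].
Proof.
by move=> Tt; rewrite unitmxE unitfE det_trig //; apply/prodf_neq0/forallP;
  [move=> h i; apply: h|move=> h i _; apply: h].
Qed.

Lemma mxsub_trig_unit n k (T : 'M[C]_n) : is_trig_mx T -> T \in unitmx ->
  mxsub (widen_ord (ltn_ord k)) (widen_ord (ltn_ord k)) T \in unitmx.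
Proof.
move=> Tt; rewrite trig_unit // => /forallP T0.
by rewrite unitmxE unitfE det_mxsub_trig //; apply/prodf_neq0.
Qed.

Lemma top_row_free n k (Y : 'M[C]_n) : Y \in unitmx -> row_free (top k Y).
Proof.
move=> Yu; apply/row_freeP.
exists (invmx Y *m colsub (widen_ord (ltn_ord k)) 1%:M).
rewrite mulmxA -top_mulmx mulmxV //; apply/matrixP => i j.
rewrite !mxE (bigD1 (widen_ord (ltn_ord k) i)) //= big1 ?addr0 => [|x xi].
  by rewrite !mxE eqxx mul1r -!val_eqE.
by rewrite !mxE eq_sym (negPf xi) mul0r.
Qed.

Lemma top_unitary n k (Q : 'M[C]_n) :
  Q \is unitarymx -> top k Q \is unitarymx.
Proof.
move=> /unitarymxP QQ; apply/unitarymxP.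
have -> : top k Q *m (top k Q)^t* = mxsub (widen_ord (ltn_ord k))
   (widen_ord (ltn_ord k)) (Q *m Q^t*).
  by apply/matrixP => i j; rewrite !mxE; apply: eq_bigr => x _; rewrite !mxE.
by rewrite QQ; apply/matrixP => i j; rewrite !mxE -!val_eqE.
Qed.

(** The Gram-Schmidt basis of the rows; the change of basis is triangular
    because each row lies in the span of the preceding basis vectors. *)
Lemma QR_decomp n (Y : 'M[C]_n) : Y \in unitmx ->
  exists T Q, [/\ is_trig_mx T, T \in unitmx, Q \is unitarymx & Y = T *m Q].
Proof.
move=> Yu; set S := schmidt Y.
have Su : S \is unitarymx by apply: schmidt_unitarymx.
have eY : Y = Y *m S^t* *m S by rewrite -mulmxA unitary_adjK // mulmx1.
exists (Y *m S^t*), S; split => //; last first.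
  by rewrite unitmx_mul Yu adj_unit unitarymx_unit.
apply/is_trig_mxP => i j ij.
have : (row i Y <= kermx ((row j S)^t*))%MS.
  apply: (submx_trans (row_schmidt_sub Y i)); apply/sumsmx_subP => k ki.
  rewrite genmxE; apply/sub_kermxP; apply/matrixP => a b.
  have /unitarymxP/matrixP/(_ k j) := Su; rewrite !mxE => e.
  rewrite (eq_bigr (fun x => S k x * S^t* x j)); last by move=> x _; rewrite !mxE.
  by rewrite e -val_eqE (ltn_eqF (leq_ltn_trans ki ij)).
move/sub_kermxP/matrixP/(_ 0 0); rewrite [LHS]mxE [RHS]mxE => e; rewrite mxE.
by apply: etrans e; apply: eq_bigr => x _; rewrite !mxE.
Qed.

(** The complete flag of the leading row spaces of [Y], with the weights [w],
    encoded as a Hermitian matrix. By summation by parts its eigenvalues are the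
    [w k], the [k]-th eigenvector being the [k]-th Gram-Schmidt vector of [Y].
    Every sum over [k < n] refers to the weight [w n], which will be 0. *)
Definition flagmx n (Y : 'M[C]_n) (w : nat -> R) : 'M[C]_n :=
  \sum_(k < n) (toC (w k - w k.+1)) *: rowproj (top k Y).

Lemma abel_sum (n : nat) (w : nat -> R) (x : 'I_n -> R) : w n = 0 ->
  \sum_(k < n) (w k - w k.+1) * (\sum_(i < n | (i <= k)%N) x i)
    = \sum_(i < n) w i * x i.
Proof.
move=> wn.
transitivity (\sum_(k < n) \sum_(i < n) (w k - w k.+1) * ((i <= k)%N%:R * x i)).
  apply: eq_bigr => k _; rewrite big_mkcond mulr_sumr; apply: eq_bigr => i _.
  by case: leqP => _; rewrite ?mul1r ?mul0r.
rewrite exchange_big; apply: eq_bigr => i _ /=.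
under eq_bigr do rewrite mulrA.
rewrite -mulr_suml; congr (_ * _).
have -> : w i = w i - w n by rewrite wn subr0.
rewrite -(big_mkord xpredT (fun k => (w k - w k.+1) * (i <= k)%N%:R)).
have lein : (i <= n)%N by exact: ltnW.
rewrite (@big_cat_nat _ _ _ i 0 n _ _ (leq0n i) lein) /= big_nat_cond big1.
  rewrite add0r -opprB -(telescope_sumr _ lein) -sumrN.
  by rewrite big_nat [RHS]big_nat; apply: eq_bigr => k /andP[ik _];
    rewrite ik mulr1 opprB.
by move=> k /andP[/andP[_ ki] _]; rewrite leqNgt ki mulr0.
Qed.

Lemma rowproj_top n k (T Q : 'M[C]_n) : is_trig_mx T -> T \in unitmx ->
  Q \is unitarymx ->
  rowproj (top k (T *m Q)) = Q^t* *m rdiag (fun i : 'I_n => (i <= k)%N%:R) *m Q.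
Proof.
move=> Tt Tu Qu; rewrite top_trig // rowproj_unitary ?mxsub_trig_unit //;
  last exact: top_unitary.
apply/matrixP => i j; rewrite !mxE.
rewrite [RHS](bigID (fun x : 'I_n => (x < k.+1)%N)) /=.
rewrite [X in _ = _ + X]big1 => [|x kx].
  rewrite addr0 (big_ord_narrow (ltn_ord k)) /=.
  apply: eq_bigr => x _; rewrite mul_mx_diag !mxE /=.
  have -> : (x <= k)%N by rewrite -ltnS.
  by rewrite rmorph1 mulr1.
rewrite mul_mx_diag !mxE -ltnS (negPf kx).
by rewrite rmorph0 mulr0 mul0r.
Qed.

Lemma flagmx_QR n (T Q : 'M[C]_n) w : is_trig_mx T -> T \in unitmx ->
  Q \is unitarymx -> w n = 0 ->
  flagmx (T *m Q) w = Q^t* *m rdiag (fun i : 'I_n => w i) *m Q.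
Proof.
move=> Tt Tu Qu wn; rewrite /flagmx.
transitivity (Q^t* *m (\sum_(k < n)
    rdiag (fun i : 'I_n => (w k - w k.+1) * (i <= k)%N%:R)) *m Q).
  rewrite mulmx_sumr mulmx_suml; apply: eq_bigr => k _.
  by rewrite rowproj_top // rdiagZ -scalemxAr -scalemxAl.
congr (_ *m _ *m _); apply/matrixP => i j; rewrite summxE.
have [->|ij] := eqVneq i j; last first.
  by rewrite mxE (negPf ij) mulr0n big1 // => k _; rewrite mxE (negPf ij).
rewrite !mxE eqxx mulr1n.
rewrite (eq_bigr (fun k : 'I_n =>
   (toC ((w k - w k.+1) * \sum_(i < n | (i <= k)%N) (i == j)%:R)))).
  rewrite -rmorph_sum abel_sum //; congr ((toC _)).
  by rewrite (bigD1 j) //= eqxx mulr1 big1 ?addr0 // => x /negPf->;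
    rewrite mulr0.
move=> k _; rewrite !mxE eqxx mulr1n; congr (toC (_ * _)).
rewrite big_mkcond (bigD1 j) //= eqxx big1 ?addr0; first by case: leqP.
by move=> x /negPf->; case: ifP.
Qed.

Lemma flagmx_unitary n (U : 'M[C]_n) w : U \is unitarymx -> w n = 0 ->
  flagmx U w = U^t* *m rdiag (fun i : 'I_n => w i) *m U.
Proof.
by move=> Uu wn; rewrite -{1}[U]mul1mx flagmx_QR // ?unitmx1.
Qed.

Lemma flagmxP n (Y : 'M[C]_n) w : Y \in unitmx -> w n = 0 ->
  exists2 Q, Q \is unitarymx &
    flagmx Y w = Q^t* *m rdiag (fun i : 'I_n => w i) *m Q.
Proof.
by move=> /QR_decomp[T [Q [Tt Tu Qu ->]]] wn; exists Q => //;
  rewrite flagmx_QR.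
Qed.

Lemma flagmx_mulr_unitary n (Y U : 'M[C]_n) w : U \is unitarymx ->
  flagmx (Y *m U) w = U^t* *m flagmx Y w *m U.
Proof.
move=> Uu; rewrite /flagmx mulmx_sumr mulmx_suml; apply: eq_bigr => k _.
by rewrite top_mulmx rowproj_mulr_unitary // -scalemxAr -scalemxAl.
Qed.

Lemma flagmx_conj n (Y : 'M[C]_n) w :
  flagmx (map_mx conjC Y) w = map_mx conjC (flagmx Y w).
Proof.
rewrite /flagmx rmorph_sum /=; apply: eq_bigr => k _.
rewrite map_mxZ -rowproj_conj.
have -> : map_mx conjC (top k Y) = top k (map_mx conjC Y).
  by apply/matrixP => i j; rewrite !mxE.
by congr (_ *: _); apply/esym/CrealP; rewrite complex_real.
Qed.

End Flags.

(** * The Kempf-Ness function *)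

Section KempfNess.
Context {R : realType}.
Local Notation C := (cplx R).

(** The squared Frobenius norm. *)
Definition frob2 m n (A : 'M[C]_(m, n)) : R := \sum_i \sum_j sqn (A i j).

Lemma frob2_ge0 m n (A : 'M[C]_(m, n)) : 0 <= frob2 A.
Proof. by do 2![apply: sumr_ge0 => ? _]; exact: sqn_ge0. Qed.

Lemma frob2E m n (A : 'M[C]_(m, n)) : (toC (frob2 A)) = \tr (A *m A^t*).
Proof. by rewrite tr_mul_adj. Qed.

Lemma frob2_unitary_congr n (U A : 'M[C]_n) : U \is unitarymx ->
  frob2 (U *m A *m U^t*) = frob2 A.
Proof.
move=> Uu; have UU := unitary_adjK Uu; apply: toC_inj; rewrite !frob2E !adjmxM adjmxK.
have -> : U *m A *m U^t* *m (U *m (A^t* *m U^t*)) = U *m (A *m A^t*) *m U^t*.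
  by rewrite -!mulmxA (mulmxA (U^t*) U) UU mul1mx.
by rewrite mxtrace_mulC (mulmxA (U^t*) U) UU mul1mx.
Qed.

Lemma ln_add_le (a b c : R) : 0 < a -> 0 < b ->
  a * expR c <= b -> ln a + c <= ln b.
Proof. by move=> a0 b0 le; rewrite -ler_expR expRD !lnK. Qed.

Lemma ln_le_add (a b c : R) : 0 < a -> 0 < b ->
  b <= a * expR c -> ln b <= ln a + c.
Proof. by move=> a0 b0 le; rewrite -ler_expR expRD !lnK. Qed.

(** The polar decomposition of [g], seen through the Gram matrix: up to a
    unitary factor on the right, [g] is [U^t* *m rdiag (expR \o l)]. *)
Lemma unitary_polar n (g : 'M[C]_n) : g \in unitmx ->
  exists U (l : 'I_n -> R), U \is unitarymx /\
    g *m g^t* = U^t* *m rdiag (fun i => expR (2 * l i)) *m U.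
Proof.
move=> gu; have gh : (g *m g^t*)^t* = g *m g^t* by rewrite adjmxM adjmxK.
have [U [d [Uu e]]] := hermitian_diag gh.
have d0 i : 0 < d i.
  have dE : d i = \sum_j sqn ((U *m g) i j).
    have := unitary_congr_eq Uu e; rewrite !mulmxA -mulmxA -adjmxM.
    move=> /matrixP/(_ i i); rewrite mul_adj_diagE !mxE eqxx mulr1n.
    by move=> /toC_inj.
  rewrite lt_neqAle dE sumr_ge0 ?andbT; last by move=> *; exact: sqn_ge0.
  rewrite -dE eq_sym; apply/negP => /eqP di0.
  have : \det (g *m g^t*) != 0.
    by rewrite -unitfE -unitmxE unitmx_mul gu adj_unit.
  rewrite e det_unitary_congr // det_rdiag (bigD1 i) //= di0 mul0r.
  by rewrite eqxx.
exists U, (fun i => ln (d i) / 2); split; first exact: Uu.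
rewrite (_ : (fun i => _) = d) //; apply/funext => i.
by rewrite mulrC divfK ?pnatr_eq0 // lnK ?posrE.
Qed.

Section Fixed.
Context {n : nat} {I : finType} (X : I -> 'M[C]_n) (w : I -> nat -> R).

(** The group of invertible matrices acts on the right on the flags of the
    [X i]. A critical point of this function of [g] is a matrix that moves the
    flags to a position where their weighted sum [moment g] vanishes. *)
Definition kempf_ness (g : 'M[C]_n) : R :=
  \sum_i \sum_(k < n) (w i k - w i k.+1) * ln (gramdet (top k (X i *m g))).

(** Half the gradient of the Kempf-Ness function at [g], by [kn_tangent] and
    [kn_variation]. *)
Definition moment (g : 'M[C]_n) : 'M[C]_n := \sum_i flagmx (X i *m g) (w i).

Lemma gramdet_eq_of_gram m (Y : 'M[C]_(m, n)) (g h : 'M[C]_n) :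
  g *m g^t* = h *m h^t* -> gramdet (Y *m g) = gramdet (Y *m h).
Proof.
move=> e; rewrite /gramdet !adjmxM !mulmxA -!(mulmxA Y).
by rewrite e.
Qed.

Lemma kn_eq_of_gram g h : g *m g^t* = h *m h^t* -> kempf_ness g = kempf_ness h.
Proof.
move=> e; apply: eq_bigr => i _; apply: eq_bigr => k _.
by rewrite !top_mulmx (gramdet_eq_of_gram _ e).
Qed.

Lemma kn_unitary U : U \is unitarymx -> kempf_ness U = kempf_ness 1%:M.
Proof.
move=> Uu; apply: kn_eq_of_gram.
by rewrite (unitarymxP Uu) adjmx1 mulmx1.
Qed.

Lemma moment_mulr_unitary g U : U \is unitarymx ->
  moment (g *m U) = U^t* *m moment g *m U.
Proof.
move=> Uu; rewrite /moment mulmx_sumr mulmx_suml; apply: eq_bigr => i _.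
by rewrite mulmxA flagmx_mulr_unitary.
Qed.

Lemma re_tr_moment g H : re (\tr (moment g *m H)) =
  \sum_i \sum_(k < n) (w i k - w i k.+1) *
     re (\tr (rowproj (top k (X i *m g)) *m H)).
Proof.
rewrite /moment mulmx_suml [\tr _]raddf_sum /= re_sum; apply: eq_bigr => i _ /=.
rewrite /flagmx mulmx_suml [\tr _]raddf_sum /= re_sum; apply: eq_bigr => k _ /=.
by rewrite -scalemxAl mxtraceZ reZ.
Qed.

Hypothesis X_unit : forall i, X i \in unitmx.
Hypothesis w_last : forall i, w i n = 0.
Hypothesis w_decr : forall i k, (k.+1 < n)%N -> w i k.+1 <= w i k.

Lemma gramdet_top_last (Y : 'M[C]_n) (k : 'I_n) : Y \in unitmx -> k.+1 = n ->
  gramdet (top k Y) = sqn (\det Y).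
Proof.
move=> Yu kn; have [T [Q [Tt Tu Qu ->]]] := QR_decomp Yu.
rewrite top_trig // gramdetMl gramdet_unitary ?top_unitary // mulr1.
rewrite det_mulmx sqnM -(gramdet_square Q) gramdet_unitary // mulr1.
rewrite det_mxsub_trig // det_trig //; congr (sqn _).
by apply: eq_bigl => i; rewrite -ltnS kn ltn_ord.
Qed.

Lemma rowproj_top_last (Y : 'M[C]_n) (k : 'I_n) : Y \in unitmx -> k.+1 = n ->
  rowproj (top k Y) = 1%:M.
Proof.
move=> Yu kn; have [T [Q [Tt Tu Qu ->]]] := QR_decomp Yu.
rewrite rowproj_top // -(unitary_adjK Qu); congr (_ *m _).
rewrite -[RHS]mulmx1 -rdiag1; congr (_ *m _); apply: eq_rdiag => i.
by rewrite -ltnS kn ltn_ord.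
Qed.

Lemma last_or_lt (k : 'I_n) : k.+1 = n \/ (k.+1 < n)%N.
Proof. by have := ltn_ord k; rewrite leq_eqVlt => /orP[/eqP|]; [left|right]. Qed.

Let Xg_unit g i : g \in unitmx -> X i *m g \in unitmx.
Proof. by move=> gu; rewrite unitmx_mul X_unit. Qed.

(** Convexity of the Kempf-Ness function along the one-parameter subgroups of
    diagonal matrices, in the form of a supporting line. *)
Lemma kn_tangent g (l : 'I_n -> R) : g \in unitmx ->
  kempf_ness g + 2 * re (\tr (moment g *m rdiag l))
    <= kempf_ness (g *m rdiag (fun j => expR (l j))).
Proof.
move=> gu; rewrite re_tr_moment mulr_sumr -big_split /=; apply: ler_sum => i _.
rewrite mulr_sumr -big_split /=; apply: ler_sum => k _.
rewrite mulrCA -mulrDr.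
have Yu := Xg_unit i gu; have Yf := top_row_free k Yu.
set E := rdiag (fun j => expR (l j)).
have Eu : E \in unitmx by apply: rdiag_unit => j; rewrite gt_eqF ?expR_gt0.
rewrite mulmxA; set Y := X i *m g in Yu Yf *; clearbody Y.
have Y'u : Y *m E \in unitmx by rewrite unitmx_mul Yu Eu.
have G0 := gramdet_gt0 Yf; have G'0 := gramdet_gt0 (top_row_free k Y'u).
case: (last_or_lt k) => [kn|kn].
  rewrite (rowproj_top_last Yu kn) mul1mx (gramdet_top_last Yu kn).
  rewrite (gramdet_top_last Y'u kn) det_mulmx sqnM.
  have sY : 0 < sqn (\det Y) by rewrite -(gramdet_top_last Yu kn).
  have dE : sqn (\det E) = expR (2 * re (\tr (rdiag l))).
    rewrite det_rdiag sqn_real -expR_sum mulr_natl mulr2n expRD expr2.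
    by congr (expR _ * expR _); rewrite /mxtrace re_sum; apply: eq_bigr => j _;
       rewrite !mxE eqxx.
  by rewrite dE lnM ?posrE ?expR_gt0 // expRK.
rewrite ler_wpM2l //; first by rewrite subr_ge0 w_decr.
apply: ln_add_le G0 G'0 _; rewrite top_mulmx.
exact: gramdet_expR_ge Yf.
Qed.

(** The last term is there because the weight of the whole space has no sign:
    the inequality [gramdet_mulr_le] may be used only for the proper subspaces. *)
Lemma kn_variation g h : g \in unitmx -> h \in unitmx ->
  kempf_ness (g *m h) <= kempf_ness g + re (\tr (moment g *m (h *m h^t* - 1%:M)))
    + (\sum_i \sum_(k < n) `|w i k|)
      * `|ln (sqn (\det h)) - re (\tr (h *m h^t* - 1%:M))|.
Proof.
move=> gu hu; rewrite re_tr_moment mulr_suml -!big_split /=.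
apply: ler_sum => i _; rewrite mulr_suml -!big_split /=; apply: ler_sum => k _.
rewrite -mulrDr mulmxA.
have Yu := Xg_unit i gu; have Yf := top_row_free k Yu.
set Y := X i *m g in Yu Yf *.
have Y'u : Y *m h \in unitmx by rewrite unitmx_mul Yu.
have G0 := gramdet_gt0 Yf; have G'0 := gramdet_gt0 (top_row_free k Y'u).
case: (last_or_lt k) => [kn|kn].
  rewrite (rowproj_top_last Yu kn) mul1mx (gramdet_top_last Yu kn).
  rewrite (gramdet_top_last Y'u kn) det_mulmx sqnM.
  have sY : 0 < sqn (\det Y) by rewrite -(gramdet_top_last Yu kn).
  have sh : 0 < sqn (\det h) by rewrite sqn_gt0 -unitfE -unitmxE.
  rewrite lnM ?posrE // kn w_last subr0.
  set a := ln (sqn (\det h)); set b := re _.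
  rewrite -lerBlDl -mulrBr -normrM.
  have -> : ln (sqn (\det Y)) + a - (ln (sqn (\det Y)) + b) = a - b by ring.
  exact: ler_norm.
rewrite -[leLHS]addr0 lerD ?mulr_ge0 //.
rewrite ler_wpM2l //; first by rewrite subr_ge0 w_decr.
apply: ln_le_add G0 G'0 _; rewrite top_mulmx.
exact: gramdet_mulr_le Yf.
Qed.

(** Cauchy-Schwarz, split by the inequality [2 x <= x ^ 2 / eta + eta] so that
    the squared norm of [M] appears without a square root. *)
Lemma re_tr_rdiag_ge (M : 'M[C]_n) (l : 'I_n -> R) (L eta : R) :
  0 < eta -> (forall j, `|l j| <= L) ->
  - (L * (frob2 M / eta + eta * n%:R)) <= 2 * re (\tr (M *m rdiag l)).
Proof.
move=> eta0 lL.
have -> : 2 * re (\tr (M *m rdiag l)) = \sum_j 2 * (re (M j j) * l j).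
  rewrite -mulr_sumr /mxtrace re_sum; congr (_ * _); apply: eq_bigr => j _.
  by rewrite mul_mx_diag !mxE mulrC reZ mulrC.
have -> : - (L * (frob2 M / eta + eta * n%:R)) =
   \sum_j - (L * ((\sum_k sqn (M j k)) / eta + eta)).
  rewrite sumrN -mulr_sumr big_split /= -mulr_suml sumr_const card_ord.
  by rewrite mulr_natr.
apply: ler_sum => j _; rewrite lerNl -mulrN.
have L0 : 0 <= L by apply: le_trans (lL j).
apply: (@le_trans _ _ (2 * (`|re (M j j)| * L))).
  rewrite ler_wpM2l // -mulrN (le_trans (ler_norm _)) // normrM normrN.
  by rewrite ler_wpM2l.
set x := `|re _|.
have -> : 2 * (x * L) = L * (2 * x) by ring.
rewrite ler_wpM2l //.
apply: (@le_trans _ _ (x ^+ 2 / eta + eta)).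
  rewrite -subr_ge0.
  have -> : x ^+ 2 / eta + eta - 2 * x = (x - eta) ^+ 2 / eta.
    by field; rewrite gt_eqF.
  by rewrite divr_ge0 ?sqr_ge0 ?ltW.
rewrite lerD2r; apply: ler_wpM2r; first by rewrite invr_ge0 ltW.
rewrite (bigD1 j) //= real_normK ?num_real // -[leLHS]addr0; apply: lerD.
  by rewrite /sqn lerDl sqr_ge0.
by apply: sumr_ge0 => *; exact: sqn_ge0.
Qed.

(** Where the gradient is small a convex function cannot decrease fast; every
    direction becomes diagonal after a unitary change of basis. *)
Lemma kn_ge_near_balanced U (l : 'I_n -> R) (L eta : R) : U \is unitarymx ->
  0 < eta -> (forall j, `|l j| <= L) ->
  kempf_ness 1%:M - L * (frob2 (moment 1%:M) / eta + eta * n%:R)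
    <= kempf_ness (U^t* *m rdiag (fun j => expR (l j))).
Proof.
move=> Uu eta0 lL; have U'u := adj_unitary Uu.
apply: le_trans (kn_tangent _ (unitarymx_unit U'u)).
rewrite kn_unitary // lerD2l -(frob2_unitary_congr (moment 1%:M) Uu).
have -> : moment (U^t*) = U *m moment 1%:M *m U^t*.
  by rewrite -[in LHS](mul1mx (U^t*)) moment_mulr_unitary // adjmxK.
exact: re_tr_rdiag_ge.
Qed.

End Fixed.
End KempfNess.

(** * Slopes and growth along rays *)

Section Slopes.
Context {R : realType}.
Local Notation C := (cplx R).

Definition unitrig n (T : 'M[C]_n) := is_trig_mx T && [forall i, T i i == 1].

Lemma unitrig_det n (T : 'M[C]_n) : unitrig T -> \det T = 1.
Proof.
by case/andP=> Tt /forallP T1; rewrite det_trig // big1 // => i _; exact/eqP.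
Qed.

Lemma gramdet_top_unitrig n p k (T : 'M[C]_n) (B : 'M[C]_(n, p)) : unitrig T ->
  gramdet (top k (T *m B)) = gramdet (top k B).
Proof.
case/andP=> Tt /forallP T1; rewrite (top_trig _ _ Tt) gramdetMl (det_mxsub_trig _ Tt).
by rewrite big1 ?sqn1 ?mul1r // => i _; exact/eqP.
Qed.

(** Scaling row [i] by [expR (- s * p i)] leaves a matrix whose entries do not
    exceed those of [N]. *)
Lemma gramdet_growth_le m n (N : 'M[C]_(m, n)) (l : 'I_n -> R) (p : 'I_m -> R)
  s : 0 <= s -> (forall i j, N i j != 0 -> l j <= p i) ->
  gramdet (N *m rdiag (fun j => expR (s * l j)))
    <= expR (2 * s * (\sum_i p i) + frob2 N).
Proof.
move=> s0 lp.
pose N' : 'M[C]_(m, n) := \matrix_(i, j) (toC (expR (s * (l j - p i))) * N i j).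
have -> : N *m rdiag (fun j => expR (s * l j)) =
          rdiag (fun i => expR (s * p i)) *m N'.
  apply/matrixP => i j; rewrite mul_mx_diag mul_diag_mx !mxE mulrA -rmorphM /=.
  by rewrite -expRD -mulrDr addrC subrK mulrC.
rewrite gramdetMl expRD; apply: ler_pM; rewrite ?sqn_ge0 //.
- have [/gramdet_gt0/ltW //|] := boolP (row_free N').
  rewrite -row_leq_rank -ltnNge => rk.
  rewrite /gramdet [\det _](_ : _ = 0) ?raddf0 //; apply/eqP.
  rewrite -[_ == 0]negbK -unitfE -unitmxE -row_free_unit -row_leq_rank -ltnNge.
  by rewrite (leq_ltn_trans _ rk) // mxrankM_maxl.
- rewrite det_rdiag sqn_real -expR_sum -expRM_natl ler_expR.
  by rewrite -mulr_sumr mulrA.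
apply: (le_trans (det_gram_le_expR _)); rewrite ler_expR.
rewrite -[leRHS]subr0 lerB ?ler0n //.
apply: ler_sum => i _; apply: ler_sum => j _; rewrite mxE sqnM.
have [->|/lp le] := eqVneq (N i j) 0.
  have -> : sqn (0 : C) = 0 by apply/eqP; rewrite sqn_eq0.
  by rewrite mulr0.
rewrite ler_piMl ?sqn_ge0 // sqn_real -[leRHS](expr1n _ 2) lerXn2r //;
  rewrite ?nnegrE ?expR_ge0 //.
by rewrite -[leRHS]expR0 ler_expR mulr_ge0_le0 // subr_le0.
Qed.

(** A single nonzero minor already grows at this rate. *)
Lemma gramdet_growth_ge m n (N : 'M[C]_(m, n)) (l : 'I_n -> R)
  (f : 'I_m -> 'I_n) s : row_free N -> injective f ->
  sqn (\det (colsub f N)) * expR (2 * s * (\sum_i l (f i)))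
    <= gramdet (N *m rdiag (fun j => expR (s * l j))).
Proof.
move=> Nf fI; set E := rdiag _.
have Eu : E \in unitmx by apply: rdiag_unit => j; rewrite gt_eqF ?expR_gt0.
have NEf : row_free (N *m E).
  apply/row_freeP; have /row_freeP[B NB] := Nf.
  by exists (invmx E *m B); rewrite -mulmxA mulKVmx.
apply: le_trans (minor_le_gramdet fI NEf).
have -> : colsub f (N *m E) =
          colsub f N *m rdiag (fun i => expR (s * l (f i))).
  by apply/matrixP => i j; rewrite mxE /E /rdiag !mul_mx_diag !mxE.
rewrite det_mulmx sqnM det_rdiag sqn_real -expR_sum -expRM_natl.
by rewrite -mulr_sumr mulrA.
Qed.

(** Gaussian elimination by rows that never uses a later row to modify an
    earlier one; in each row the pivot is placed where [l] is largest. *)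
Lemma echelon_rect m n (B : 'M[C]_(m, n)) (l : 'I_n -> R) : row_free B ->
  exists T (f : 'I_m -> 'I_n), [/\ unitrig T,
    forall k j, (T *m B) k j != 0 -> l j <= l (f k),
    forall i k : 'I_m, (i < k)%N -> (T *m B) k (f i) = 0 &
    forall k, (T *m B) k (f k) != 0].
Proof.
elim: m => [|m IH] in B *.
  move=> _; exists 1%:M, (fun i : 'I_0 => False_rect _ (notF (ltn_ord i))).
  split; [|by case|by case|by case].
  by apply/andP; split; [apply/is_trig_mxP => -[]|apply/forallP => -[]].
rewrite -[m.+1]/(1 + m)%N in B *; move=> Bf.
have [b [B1 eB]] : exists (b : 'rV[C]_n) (B1 : 'M[C]_(m, n)), B = col_mx b B1.
  by exists (usubmx B), (dsubmx B); rewrite vsubmxK.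
have [j0 bj0] : exists j, b 0 j != 0.
  apply/existsP; apply: contraLR Bf; rewrite negb_exists => /forallP b0.
  have {}b0 : b = 0.
    by apply/matrixP => i j; rewrite ord1 [RHS]mxE; apply/eqP; have := b0 j; rewrite negbK.
  by rewrite -row_leq_rank -ltnNge eB b0 rank_col_0mx ltnS rank_leq_row.
case: (@arg_maxP _ _ _ j0 (fun j => b 0 j != 0) l bj0) => j1 bj1 lmax.
pose c : 'cV[C]_m := \col_i (B1 i j1 / b 0 j1).
pose B2 := B1 - c *m b.
have B2j i : B2 i j1 = 0.
  by rewrite !mxE big_ord1 !mxE divfK // subrr.
have B2f : row_free B2.
  apply: inj_row_free => v vB.
  have : row_mx (- (v *m c)) v *m B = 0.
    by rewrite eB mul_row_col mulNmx -mulmxA addrC -mulmxBr.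
  rewrite -(mul0mx _ B) => /(row_free_inj Bf).
  by rewrite -row_mx0 => /eq_row_mx[].
have [T2 [f2 [T2u supp2 zero2 piv2]]] := IH B2 B2f.
pose T : 'M[C]_(1 + m) := block_mx 1%:M 0 (- (T2 *m c)) T2.
have TB : T *m B = col_mx b (T2 *m B2).
  rewrite eB mul_block_col mul1mx mul0mx addr0 mulNmx -mulmxA addrC.
  by rewrite -mulmxBr.
have TBj i : (T2 *m B2) i j1 = 0.
  by rewrite mxE big1 // => x _; rewrite B2j mulr0.
pose f (i : 'I_(1 + m)) := if split i is inr i' then f2 i' else j1.
have f0 i : f (lshift m i) = j1.
  by rewrite /f -/(unsplit (inl i)) unsplitK.
have fS i : f (rshift 1 i) = f2 i.
  by rewrite /f -/(unsplit (inr i)) unsplitK.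
exists T, f; rewrite TB; split.
- case/andP: T2u => T2t /forallP T21; rewrite /unitrig is_trig_block_mx //.
  rewrite eqxx /= T2t mx11_is_trig /=; apply/forallP => i.
  rewrite /T; case: (split_ordP i) => i' ->.
    by rewrite block_mxEul mxE eqxx.
  by rewrite block_mxEdr.
- move=> k j; case: (split_ordP k) => k' ->; rewrite ?f0 ?fS.
    by rewrite col_mxEu ord1 => /lmax.
  by rewrite col_mxEd; exact: supp2.
- move=> i k; case: (split_ordP k) => k' ->; case: (split_ordP i) => i' ->.
  + by rewrite /= !ord1.
  + by rewrite /= !ord1.
  + by rewrite f0 col_mxEd TBj.
  + by rewrite fS col_mxEd /= => ik; apply: zero2; rewrite -(ltn_add2l 1).
- move=> k; case: (split_ordP k) => k' ->; rewrite ?f0 ?fS.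
    by rewrite col_mxEu ord1.
  by rewrite col_mxEd.
Qed.

Lemma echelon n (B : 'M[C]_n) (l : 'I_n -> R) : B \in unitmx ->
  exists T (p : 'S_n), [/\ unitrig T,
    forall k j, (T *m B) k j != 0 -> l j <= l (p k),
    forall i k : 'I_n, (i < k)%N -> (T *m B) k (p i) = 0 &
    forall k, (T *m B) k (p k) != 0].
Proof.
rewrite -row_free_unit => /(echelon_rect l)[T [f [Tu supp zero piv]]].
have fI : injective f.
  move=> i k eik; apply: val_inj; case: (ltngtP i k) => // ik.
    by have := piv k; rewrite -eik zero ?eqxx.
  by have := piv i; rewrite eik zero ?eqxx.
exists T, (perm fI); split => //.
- by move=> k j; rewrite permE; exact: supp.
- by move=> i k ik; rewrite permE zero.
- by move=> k; rewrite permE.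
Qed.

Lemma pivot_minor_neq0 n (M : 'M[C]_n) (p : 'S_n) (k : 'I_n) :
  (forall i j : 'I_n, (i < j)%N -> M j (p i) = 0) ->
  (forall j, M j (p j) != 0) ->
  \det (colsub (fun j => p (widen_ord (ltn_ord k) j)) (top k M)) != 0.
Proof.
move=> zero piv; rewrite -det_tr det_trig.
  by apply/prodf_neq0 => a _; rewrite !mxE.
by apply/is_trig_mxP => a b ab; rewrite !mxE zero.
Qed.

Section Family.
Context {n : nat} {I : finType} (X : I -> 'M[C]_n) (w : I -> nat -> R).

(** Half the rate of growth, along the ray [K *m rdiag (expR (s * l j))], of the
    Kempf-Ness function when the flag of [X i *m K] has its pivots in the
    positions [p i]. *)
Definition slope (p : I -> 'S_n) (l : 'I_n -> R) : R :=
  \sum_i \sum_(k < n) w i k * l (p i k).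

Hypothesis X_unit : forall i, X i \in unitmx.
Hypothesis w_last : forall i, w i n = 0.
Hypothesis w_decr : forall i k, (k.+1 < n)%N -> w i k.+1 <= w i k.

Let psum (p : I -> 'S_n) (l : 'I_n -> R) i (k : 'I_n) : R :=
  \sum_(j < n | (j <= k)%N) l (p i j).

Let slopeE p l s : 2 * s * slope p l =
  \sum_i \sum_(k < n) (w i k - w i k.+1) * (2 * s * psum p l i k).
Proof.
rewrite /slope mulr_sumr; apply: eq_bigr => i _.
rewrite -(abel_sum (fun j => l (p i j)) (w_last i)) mulr_sumr.
by apply: eq_bigr => k _; rewrite mulrCA.
Qed.

Let psum_narrow (p : I -> 'S_n) l i (k : 'I_n) :
  \sum_(j < k.+1) l (p i (widen_ord (ltn_ord k) j)) = psum p l i k.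
Proof.
rewrite /psum (eq_bigl (fun j : 'I_n => (j < k.+1)%N)) //.
by rewrite (big_ord_narrow (ltn_ord k)).
Qed.

Let last_growth (K : 'M[C]_n) (p : I -> 'S_n) l i (k : 'I_n) s :
  K \in unitmx -> k.+1 = n ->
  ln (gramdet (top k (X i *m (K *m rdiag (fun j => expR (s * l j))))))
    = 2 * s * psum p l i k + ln (sqn (\det (X i *m K))).
Proof.
move=> Ku kn; set E := rdiag _.
have Eu : E \in unitmx by apply: rdiag_unit => j; rewrite gt_eqF ?expR_gt0.
have XKu : X i *m K \in unitmx by rewrite unitmx_mul X_unit Ku.
have XKEu : X i *m (K *m E) \in unitmx.
  by rewrite unitmx_mul X_unit unitmx_mul Ku Eu.
rewrite (gramdet_top_last XKEu kn) mulmxA det_mulmx sqnM mulrC.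
have d0 : 0 < sqn (\det (X i *m K)) by rewrite sqn_gt0 -unitfE -unitmxE.
rewrite det_rdiag sqn_real -expR_sum -expRM_natl lnM ?posrE ?expR_gt0 //.
rewrite expRK -mulr_sumr mulrA; congr (_ * _ + _).
rewrite (reindex_inj (@perm_inj _ (p i))) /psum /=.
by apply: eq_bigl => j; rewrite -ltnS kn ltn_ord.
Qed.

(** An upper bound on the growth only needs an upper bound on the position of
    the nonzero entries in each row. Left multiplication by a unitriangular
    matrix does not change the flags. *)
Lemma kn_growth_le (K : 'M[C]_n) (T : I -> 'M[C]_n) (p : I -> 'S_n)
    (l : 'I_n -> R) :
  K \in unitmx -> (forall i, unitrig (T i)) ->
  (forall i k j, (T i *m (X i *m K)) k j != 0 -> l j <= l (p i k)) ->
  exists c, forall s, 0 <= s ->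
    kempf_ness X w (K *m rdiag (fun j => expR (s * l j))) <= 2 * s * slope p l + c.
Proof.
move=> Ku Tu supp.
pose c i (k : 'I_n) := if k.+1 == n then ln (sqn (\det (X i *m K)))
  else frob2 (top k (T i *m (X i *m K))).
exists (\sum_i \sum_(k < n) (w i k - w i k.+1) * c i k) => s s0.
rewrite slopeE -big_split; apply: ler_sum => i _ /=.
rewrite -big_split; apply: ler_sum => k _ /=.
rewrite -mulrDr /c; case: (last_or_lt k) => [kn|kn].
  by rewrite (introT eqP kn) (last_growth p _ _ _ Ku kn).
rewrite (ltn_eqF kn); apply: ler_wpM2l; first by rewrite subr_ge0 w_decr.
set E := rdiag _.
have Eu : E \in unitmx by apply: rdiag_unit => j; rewrite gt_eqF ?expR_gt0.
have XKEu : X i *m (K *m E) \in unitmx.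
  by rewrite unitmx_mul X_unit unitmx_mul Ku Eu.
rewrite -[leRHS]expRK ler_ln ?posrE ?expR_gt0 ?gramdet_gt0 ?top_row_free //.
rewrite -(gramdet_top_unitrig k _ (Tu i)) mulmxA mulmxA -(mulmxA (T i)).
rewrite top_mulmx -psum_narrow.
apply: gramdet_growth_le => // a b; rewrite mxE; exact: supp.
Qed.

(** A lower bound needs nonzero pivots as well; with both, the rate is exact. *)
Lemma kn_growth_ge (K : 'M[C]_n) (T : I -> 'M[C]_n) (p : I -> 'S_n)
    (l : 'I_n -> R) :
  K \in unitmx -> (forall i, unitrig (T i)) ->
  (forall i (a b : 'I_n), (a < b)%N -> (T i *m (X i *m K)) b (p i a) = 0) ->
  (forall i a, (T i *m (X i *m K)) a (p i a) != 0) ->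
  exists c, forall s,
    2 * s * slope p l + c <= kempf_ness X w (K *m rdiag (fun j => expR (s * l j))).
Proof.
move=> Ku Tu zero piv.
pose pk i (k : 'I_n) (j : 'I_k.+1) := p i (widen_ord (ltn_ord k) j).
pose c i (k : 'I_n) := if k.+1 == n then ln (sqn (\det (X i *m K)))
  else ln (sqn (\det (colsub (@pk i k) (top k (T i *m (X i *m K)))))).
exists (\sum_i \sum_(k < n) (w i k - w i k.+1) * c i k) => s.
rewrite slopeE -big_split; apply: ler_sum => i _ /=.
rewrite -big_split; apply: ler_sum => k _ /=.
rewrite -mulrDr /c; case: (last_or_lt k) => [kn|kn].
  by rewrite (introT eqP kn) (last_growth p _ _ _ Ku kn).
rewrite (ltn_eqF kn); apply: ler_wpM2l; first by rewrite subr_ge0 w_decr.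
set E := rdiag _.
have Eu : E \in unitmx by apply: rdiag_unit => j; rewrite gt_eqF ?expR_gt0.
have XKEu : X i *m (K *m E) \in unitmx.
  by rewrite unitmx_mul X_unit unitmx_mul Ku Eu.
have TXKu : T i *m (X i *m K) \in unitmx.
  rewrite unitmx_mul; apply/andP; split; last by rewrite unitmx_mul X_unit Ku.
  by rewrite unitmxE unitrig_det ?unitr1.
have G0 : 0 < gramdet (top k (X i *m (K *m E))).
  exact: gramdet_gt0 (top_row_free k XKEu).
set D := \det _.
have D0 : D != 0 by apply: pivot_minor_neq0 (zero i) (piv i).
have sD0 : 0 < sqn D by rewrite sqn_gt0.
rewrite addrC; apply: ln_add_le => //.
rewrite -(gramdet_top_unitrig k _ (Tu i)) mulmxA mulmxA -(mulmxA (T i)).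
rewrite top_mulmx -psum_narrow /D; apply: gramdet_growth_ge.
  exact: top_row_free.
by move=> a b /perm_inj /(congr1 val) /= /val_inj.
Qed.

End Family.
End Slopes.

(** * Convergence of complex matrices *)

Section Convergence.
Context {R : realType}.
Local Notation C := (cplx R).
Definition tends (x : nat -> R) (l : R) : Prop := (x @ \oo --> l)%classic.
Local Notation "x ---> l" := (tends x l) (at level 70).

Lemma tendsP (x : nat -> R) l : (x ---> l) <->
  forall e, 0 < e -> exists N, forall k, (N <= k)%N -> `|l - x k| < e.
Proof.
split=> [/cvgrPdist_lt h e e0|h].
  by have [N _ HN] := h e e0; exists N => k Nk; apply: HN.
by apply/cvgrPdist_lt => e e0; have [N HN] := h e e0; exists N.
Qed.

Lemma tends_le (x : nat -> R) l a :
  (x ---> l) -> (exists N, forall k, (N <= k)%N -> x k <= a) -> l <= a.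
Proof.
move=> xl [N HN]; rewrite leNgt; apply/negP => al.
have [|M HM] := (tendsP x l).1 xl (l - a); first by rewrite subr_gt0.
have := HM (maxn N M) (leq_maxr _ _).
have := HN (maxn N M) (leq_maxl _ _) => h1 h2.
have := le_lt_trans (ler_norm _) h2.
by rewrite ltrD2l ltrN2 ltNge h1.
Qed.

Lemma tends_unique (x : nat -> R) l l' : (x ---> l) -> (x ---> l') -> l = l'.
Proof. exact: cvg_unique. Qed.

Lemma tends_sub (x : nat -> R) l (f : nat -> nat) :
  (forall k, k <= f k)%N -> (x ---> l) -> (fun k => x (f k)) ---> l.
Proof.
move=> kf /tendsP h; apply/tendsP => e /h[N HN]; exists N => k Nk.
by apply: HN; apply: leq_trans Nk (kf k).
Qed.

Lemma tends_cst (l : R) : (fun=> l) ---> l.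
Proof. exact: cvg_cst. Qed.

Lemma tendsD (x y : nat -> R) a b :
  (x ---> a) -> (y ---> b) -> (fun k => x k + y k) ---> (a + b).
Proof. exact: cvgD. Qed.

Lemma tendsM (x y : nat -> R) a b :
  (x ---> a) -> (y ---> b) -> (fun k => x k * y k) ---> (a * b).
Proof. exact: cvgM. Qed.

Lemma tendsN (x : nat -> R) a : (x ---> a) -> (fun k => - x k) ---> - a.
Proof. exact: cvgN. Qed.

Lemma tendsV (x : nat -> R) a :
  a != 0 -> (x ---> a) -> (fun k => (x k)^-1) ---> a^-1.
Proof. exact: cvgV. Qed.

Lemma tends_sum (I : Type) (r : seq I) (x : I -> nat -> R) (l : I -> R) :
  (forall i, x i ---> l i) ->
  (fun k => \sum_(i <- r) x i k) ---> \sum_(i <- r) l i.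
Proof.
move=> xl; elim: r => [|i r IH].
  by rewrite big_nil; under eq_fun do rewrite big_nil; exact: tends_cst.
by rewrite big_cons; under eq_fun do rewrite big_cons; exact: tendsD.
Qed.

Lemma tends_ln (x : nat -> R) l : 0 < l -> (x ---> l) ->
  (fun k => ln (x k)) ---> ln l.
Proof. by move=> l0 xl; apply: continuous_cvg xl; exact: continuous_ln. Qed.

Lemma tends_expR (x : nat -> R) l : (x ---> l) ->
  (fun k => expR (x k)) ---> expR l.
Proof. by move=> xl; apply: continuous_cvg xl; exact: continuous_expR. Qed.

(** Taken componentwise, which avoids a topology on [C]. *)
Definition cvC (z : nat -> C) (l : C) :=
  ((fun k => re (z k)) ---> re l) /\ ((fun k => im (z k)) ---> im l).

Lemma imD (x y : C) : im (x + y) = im x + im y.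
Proof. by rewrite /im mulrDr raddfD. Qed.

Lemma reM (x y : C) : re (x * y) = re x * re y - im x * im y.
Proof.
apply: toC_inj; rewrite rmorphB !rmorphM /= !toC_im !toC_re.
by rewrite ReM.
Qed.

Lemma imM (x y : C) : im (x * y) = re x * im y + re y * im x.
Proof.
apply: toC_inj; rewrite rmorphD !rmorphM /= !toC_im !toC_re.
by rewrite ImM.
Qed.

Lemma im_toC (x : R) : im (toC x) = 0.
Proof.
apply: toC_inj; rewrite toC_im rmorph0.
by apply/Creal_ImP; exact: toC_real.
Qed.

Lemma im_conj (z : C) : im z^* = - im z.
Proof. by apply: toC_inj; rewrite rmorphN /= !toC_im Im_conj. Qed.

Lemma eq_re_im (x y : C) : re x = re y -> im x = im y -> x = y.
Proof.
by move=> er ei; rewrite (Crect x) (Crect y) -!toC_im -!toC_re er ei.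
Qed.

Lemma cvC_unique z l l' : cvC z l -> cvC z l' -> l = l'.
Proof.
by move=> [a b] [a' b']; apply: eq_re_im; [exact: tends_unique a a'|
  exact: tends_unique b b'].
Qed.

Lemma cvC_cst l : cvC (fun=> l) l.
Proof. by split; exact: tends_cst. Qed.

Lemma cvC_toC x l : (x ---> l) -> cvC (fun k => toC (x k)) (toC l).
Proof.
move=> xl; split=> //.
under eq_fun do rewrite im_toC.
by rewrite im_toC; exact: tends_cst.
Qed.

Lemma cvCD x y a b : cvC x a -> cvC y b -> cvC (fun k => x k + y k) (a + b).
Proof.
move=> [xr xi] [yr yi]; split; rewrite ?raddfD ?imD.
  by under eq_fun do rewrite raddfD; exact: tendsD.
by under eq_fun do rewrite imD; exact: tendsD.
Qed.

Lemma cvCM x y a b : cvC x a -> cvC y b -> cvC (fun k => x k * y k) (a * b).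
Proof.
move=> [xr xi] [yr yi]; split; rewrite ?reM ?imM.
  by under eq_fun do rewrite reM; by apply: tendsD; [exact: tendsM|apply: tendsN; exact: tendsM].
by under eq_fun do rewrite imM; apply: tendsD; exact: tendsM.
Qed.

Lemma cvC_conj x a : cvC x a -> cvC (fun k => (x k)^*) (a^*).
Proof.
move=> [xr xi]; split; rewrite ?re_conj ?im_conj.
  by under eq_fun do rewrite re_conj.
by under eq_fun do rewrite im_conj; exact: tendsN.
Qed.

Lemma cvC_sum (I : Type) (r : seq I) (x : I -> nat -> C) l :
  (forall i, cvC (x i) (l i)) ->
  cvC (fun k => \sum_(i <- r) x i k) (\sum_(i <- r) l i).
Proof.
move=> xl; elim: r => [|i r IH].
  by rewrite big_nil; under eq_fun do rewrite big_nil; exact: cvC_cst.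
by rewrite big_cons; under eq_fun do rewrite big_cons; exact: cvCD.
Qed.

Lemma cvC_prod (I : Type) (r : seq I) (x : I -> nat -> C) l :
  (forall i, cvC (x i) (l i)) ->
  cvC (fun k => \prod_(i <- r) x i k) (\prod_(i <- r) l i).
Proof.
move=> xl; elim: r => [|i r IH].
  by rewrite big_nil; under eq_fun do rewrite big_nil; exact: cvC_cst.
by rewrite big_cons; under eq_fun do rewrite big_cons; exact: cvCM.
Qed.

Lemma tends_sqn x a : cvC x a -> (fun k => sqn (x k)) ---> sqn a.
Proof. by case=> xr xi; rewrite /sqn; apply: tendsD; exact: tendsM. Qed.

Lemma invC_sqn (z : C) : z^-1 = z^* * toC ((sqn z)^-1).
Proof.
have [->|z0] := eqVneq z 0; first by rewrite invr0 conjC0 mul0r.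
by rewrite fmorphV /= -mul_conj_sqn invfM mulrCA mulfV ?mulr1 // conjC_eq0.
Qed.

Lemma cvC_inv x a : a != 0 -> cvC x a -> cvC (fun k => (x k)^-1) a^-1.
Proof.
move=> a0 xa; rewrite invC_sqn; under eq_fun do rewrite invC_sqn.
apply: cvCM; first exact: cvC_conj.
apply: cvC_toC; apply: tendsV; first by rewrite sqn_eq0.
exact: tends_sqn.
Qed.

Definition cvMx m n (A : nat -> 'M[C]_(m, n)) (L : 'M[C]_(m, n)) :=
  forall i j, cvC (fun k => A k i j) (L i j).

Lemma cvMx_unique m n (A : nat -> 'M[C]_(m, n)) L L' :
  cvMx A L -> cvMx A L' -> L = L'.
Proof.
by move=> h h'; apply/matrixP => i j; exact: cvC_unique (h i j) (h' i j).
Qed.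

Lemma cvMx_cst m n (L : 'M[C]_(m, n)) : cvMx (fun=> L) L.
Proof. by move=> i j; exact: cvC_cst. Qed.

Lemma cvMxD m n (A B : nat -> 'M[C]_(m, n)) L M :
  cvMx A L -> cvMx B M -> cvMx (fun k => A k + B k) (L + M).
Proof.
by move=> h h' i j; under eq_fun do rewrite mxE; rewrite mxE; exact: cvCD.
Qed.

Lemma cvMxZ m n (A : nat -> 'M[C]_(m, n)) z L a :
  cvC z a -> cvMx A L -> cvMx (fun k => z k *: A k) (a *: L).
Proof.
by move=> h h' i j; under eq_fun do rewrite mxE; rewrite mxE; exact: cvCM.
Qed.

Lemma cvMx_sum m n (I : Type) (r : seq I) (A : I -> nat -> 'M[C]_(m, n)) L :
  (forall i, cvMx (A i) (L i)) ->
  cvMx (fun k => \sum_(i <- r) A i k) (\sum_(i <- r) L i).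
Proof.
move=> h i j; under eq_fun do rewrite summxE.
by rewrite summxE; apply: cvC_sum => x; exact: h.
Qed.

Lemma cvMxM m n p (A : nat -> 'M[C]_(m, n)) (B : nat -> 'M[C]_(n, p)) L M :
  cvMx A L -> cvMx B M -> cvMx (fun k => A k *m B k) (L *m M).
Proof.
move=> h h' i j; under eq_fun do rewrite mxE.
by rewrite mxE; apply: cvC_sum => x; exact: cvCM.
Qed.

Lemma cvMx_adj m n (A : nat -> 'M[C]_(m, n)) L :
  cvMx A L -> cvMx (fun k => (A k)^t*) (L^t*).
Proof.
move=> h i j; under eq_fun do rewrite !mxE.
by rewrite !mxE; exact: cvC_conj.
Qed.

Lemma cvMx_sub m n m' n' (f : 'I_m' -> 'I_m) (g : 'I_n' -> 'I_n)
    (A : nat -> 'M[C]_(m, n)) L :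
  cvMx A L -> cvMx (fun k => mxsub f g (A k)) (mxsub f g L).
Proof.
by move=> h i j; under eq_fun do rewrite mxE; rewrite mxE; exact: h.
Qed.

Lemma cvC_det n (A : nat -> 'M[C]_n) L :
  cvMx A L -> cvC (fun k => \det (A k)) (\det L).
Proof.
move=> h; apply: cvC_sum => s; apply: cvCM; first exact: cvC_cst.
by apply: cvC_prod => i; exact: h.
Qed.

Lemma cvMx_inv n (A : nat -> 'M[C]_n) L :
  (forall k, A k \in unitmx) -> L \in unitmx ->
  cvMx A L -> cvMx (fun k => invmx (A k)) (invmx L).
Proof.
move=> Au Lu h; rewrite /invmx Lu; under eq_fun do rewrite Au.
apply: cvMxZ; first by apply: cvC_inv (cvC_det h); rewrite -unitfE -unitmxE.
move=> i j; under eq_fun do rewrite mxE /cofactor; rewrite mxE /cofactor.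
apply: cvCM; first exact: cvC_cst.
apply: cvC_det => a b.
by under eq_fun do rewrite !mxE; rewrite !mxE; exact: h.
Qed.

Lemma cvMx_rdiag n (f : nat -> 'I_n -> R) l :
  (forall j, (fun k => f k j) ---> l j) -> cvMx (fun k => rdiag (f k)) (rdiag l).
Proof.
move=> h i j; under eq_fun do rewrite !mxE; rewrite !mxE.
have [->|ij] := eqVneq i j; last first.
  by under eq_fun do rewrite mulr0n; rewrite mulr0n; exact: cvC_cst.
by under eq_fun do rewrite mulr1n; rewrite mulr1n; exact: cvC_toC.
Qed.

Lemma cvMx_top n p (A : nat -> 'M[C]_(n, p)) L (j : 'I_n) :
  cvMx A L -> cvMx (fun k => top j (A k)) (top j L).
Proof. exact: cvMx_sub. Qed.

Lemma tends_gramdet m n (Y : nat -> 'M[C]_(m, n)) L :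
  cvMx Y L -> (fun k => gramdet (Y k)) ---> gramdet L.
Proof.
by move=> h; have [] := cvC_det (cvMxM h (cvMx_adj h)).
Qed.

Lemma cvMx_rowproj m n (Y : nat -> 'M[C]_(m, n)) L :
  (forall k, row_free (Y k)) -> row_free L -> cvMx Y L ->
  cvMx (fun k => rowproj (Y k)) (rowproj L).
Proof.
have gu (Z : 'M[C]_(m, n)) : row_free Z -> Z *m Z^t* \in unitmx.
  move=> /gramdet_gt0 g0; rewrite unitmxE unitfE; apply/eqP => d0.
  by move: g0; rewrite /gramdet d0 raddf0 ltxx.
move=> Yf Lf h; apply: cvMxM => //; apply: cvMxM; first exact: cvMx_adj.
apply: cvMx_inv => [k||]; [exact: gu|exact: gu|].
by apply: cvMxM => //; exact: cvMx_adj.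
Qed.

Lemma cvMx_flagmx n (Y : nat -> 'M[C]_n) L w :
  (forall k, Y k \in unitmx) -> L \in unitmx -> cvMx Y L ->
  cvMx (fun k => flagmx (Y k) w) (flagmx L w).
Proof.
move=> Yu Lu h; apply: cvMx_sum => j; apply: cvMxZ; first exact: cvC_cst.
apply: cvMx_rowproj; [by move=> k; exact: top_row_free|exact: top_row_free|].
exact: cvMx_top.
Qed.

Lemma tends_frob2 m n (A : nat -> 'M[C]_(m, n)) L :
  cvMx A L -> (fun k => frob2 (A k)) ---> frob2 L.
Proof.
move=> h; apply: tends_sum => i; apply: tends_sum => j.
exact: tends_sqn (h i j).
Qed.

(** Bolzano-Weierstrass for finitely many bounded sequences at once. *)
Lemma bounded_subsequence (T : finType) (x : nat -> T -> R) (B : R) :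
  (forall k t, `|x k t| <= B) ->
  exists (f : nat -> nat) (l : T -> R),
    (forall k, k <= f k)%N /\ forall t, (fun k => x (f k) t) ---> l t.
Proof.
move=> xB.
suff [f [kf fl]] : exists f : nat -> nat, (forall k, k <= f k)%N /\
    forall t, t \in enum T -> exists l, (fun k => x (f k) t) ---> l.
  have /choice[l fl'] : forall t, exists l, (fun k => x (f k) t) ---> l.
    by move=> t; apply: fl; rewrite mem_enum.
  by exists f, l.
elim: (enum T) => [|t r [f [kf fl]]]; first by exists id.
have [|g ginc gl] := @bolzano_weierstrass R (fun k => x (f k) t).
  exists B; split; first exact: num_real.
  by move=> M BM k _ /=; apply: le_trans (ltW BM).
have kg k : (k <= g k)%N.
  elim: k => // k IH; apply: leq_ltn_trans IH _.
  by rewrite ltnNge; apply/negP => h; have := ginc k.+1 k; rewrite leEnat h ltnn.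
exists (f \o g); split=> [k|t' /=].
  by apply: leq_trans (kg k) (kf _).
rewrite inE => /predU1P[->|/fl[l tl]]; last first.
  by exists l; exact: tends_sub kg tl.
by move/cvg_ex: gl => [l hl]; exists l.
Qed.

End Convergence.

(** * Semistability and coercivity *)

Section Semistability.
Context {R : realType}.
Local Notation C := (cplx R).
Context {n : nat} {I : finType} (X : I -> 'M[C]_n) (w : I -> nat -> R).

(** The numerical criterion of Hilbert and Mumford, in coordinates: a basis [K]
    with exponents [l] is a one-parameter subgroup, and [p i] bounds the
    position of the flag of [X i] relative to it. The condition is stated with
    vanishing of entries only, so that failing it for given [p] and a given
    ordering of the [l j] is a system of polynomial equations in [X]. *)
Definition semistable : Prop :=
  forall (K : 'M[C]_n) (T : I -> 'M[C]_n) (p : I -> 'S_n) (l : 'I_n -> R),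
    K \in unitmx -> (forall i, unitrig (T i)) ->
    (forall i k j, (T i *m (X i *m K)) k j != 0 -> l j <= l (p i k)) ->
    0 <= slope w p l.

Hypothesis X_unit : forall i, X i \in unitmx.
Hypothesis w_last : forall i, w i n = 0.
Hypothesis w_decr : forall i k, (k.+1 < n)%N -> w i k.+1 <= w i k.

Definition ray (U : 'M[C]_n) (u : 'I_n -> R) (s : R) : 'M[C]_n :=
  U^t* *m rdiag (fun j => expR (s * u j)).

Lemma ray_unit U u s : U \is unitarymx -> ray U u s \in unitmx.
Proof.
move=> Uu; rewrite unitmx_mul adj_unit unitarymx_unit //=.
by apply: rdiag_unit => j; rewrite gt_eqF ?expR_gt0.
Qed.

Lemma ray0 U u : ray U u 0 = U^t*.
Proof.
rewrite /ray (_ : (fun j => _) = fun=> 1) ?rdiag1 ?mulmx1 //.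
by apply/funext => j; rewrite mul0r expR0.
Qed.

(** Convexity along a ray: both chords are bounded by the tangent at [s]. *)
Lemma kn_chord U u (s N : R) : U \is unitarymx -> 0 <= s <= N ->
  N * kempf_ness X w (ray U u s)
    <= (N - s) * kempf_ness X w 1%:M + s * kempf_ness X w (ray U u N).
Proof.
move=> Uu /andP[s0 sN].
pose d := 2 * re (\tr (moment X w (ray U u s) *m rdiag u)).
have tan a : kempf_ness X w (ray U u s) + a * d <= kempf_ness X w (ray U u (s + a)).
  have := kn_tangent X_unit w_decr (fun j => a * u j) (ray_unit u s Uu).
  rewrite rdiagZ -scalemxAr mxtraceZ reZ mulrCA -/d.
  rewrite /ray -mulmxA rdiagM.
  rewrite (_ : (fun i => expR (s * u i) * _) =
               (fun j => expR ((s + a) * u j))) //.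
  by apply/funext => j; rewrite -expRD -mulrDl.
have := tan (- s); rewrite subrr ray0 (kn_unitary _ _ (adj_unitary Uu)) => t1.
have := tan (N - s); rewrite (addrC s) subrK => t2.
have Ns : 0 <= N - s by rewrite subr_ge0.
have := lerD (ler_wpM2l Ns t1) (ler_wpM2l s0 t2).
by apply: le_trans; rewrite le_eqVlt; apply/orP; left; apply/eqP; ring.
Qed.

Lemma tends_kn_ray (U : nat -> 'M[C]_n) (u : nat -> 'I_n -> R) U0 u0 s :
  U0 \is unitarymx -> cvMx U U0 ->
  (forall j, tends (fun k => u k j) (u0 j)) ->
  tends (fun k => kempf_ness X w (ray (U k) (u k) s)) (kempf_ness X w (ray U0 u0 s)).
Proof.
move=> U0u UU0 uu0; apply: tends_sum => i; apply: tends_sum => j.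
apply: tendsM; first exact: tends_cst.
apply: tends_ln.
  apply: gramdet_gt0; apply: top_row_free.
  by rewrite unitmx_mul X_unit ray_unit.
apply: tends_gramdet; apply: cvMx_top; apply: cvMxM; first exact: cvMx_cst.
apply: cvMxM; first exact: cvMx_adj.
apply: cvMx_rdiag => a; apply: tends_expR; apply: tendsM => //.
exact: tends_cst.
Qed.

(** In echelon form the growth along the ray is governed by the slope, which is
    nonnegative. *)
Lemma semistable_ray U u : semistable -> U \is unitarymx ->
  exists c, forall s, 0 <= s -> c <= kempf_ness X w (ray U u s).
Proof.
move=> ss Uu; have U'u := unitarymx_unit (adj_unitary Uu).
have /choice[T /choice[p Tp]] : forall i, exists T, exists p : 'S_n,
    [/\ unitrig T,
    forall k j, (T *m (X i *m U^t*)) k j != 0 -> u j <= u (p k),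
    forall a b : 'I_n, (a < b)%N -> (T *m (X i *m U^t*)) b (p a) = 0 &
    forall k, (T *m (X i *m U^t*)) k (p k) != 0].
  by move=> i; apply: echelon; rewrite unitmx_mul X_unit U'u.
have [|||c hc] := @kn_growth_ge _ _ _ X w X_unit w_last w_decr (U^t*) T p u U'u.
- by move=> i; have [] := Tp i.
- by move=> i; have [] := Tp i.
- by move=> i; have [] := Tp i.
exists c => s s0; apply: le_trans (hc s); rewrite lerDr.
rewrite !mulr_ge0 //; apply: (ss (U^t*) T) => // i; by have [] := Tp i.
Qed.

Lemma unitary_entry_sqn (U : 'M[C]_n) i j : U \is unitarymx -> sqn (U i j) <= 1.
Proof.
move=> Uu; rewrite -(unitary_row_sqn i Uu) (bigD1 j) //= lerDl.
by apply: sumr_ge0 => *; exact: sqn_ge0.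
Qed.

Lemma sqn_le1_re (z : C) : sqn z <= 1 -> `|re z| <= 1.
Proof.
move=> z1; rewrite -(@ler_pXn2r _ 2) ?nnegrE // expr1n real_normK ?num_real //.
by apply: le_trans z1; rewrite lerDl sqr_ge0.
Qed.

Lemma sqn_le1_im (z : C) : sqn z <= 1 -> `|im z| <= 1.
Proof.
move=> z1; rewrite -(@ler_pXn2r _ 2) ?nnegrE // expr1n real_normK ?num_real //.
by apply: le_trans z1; rewrite lerDr sqr_ge0.
Qed.

End Semistability.

Section UnitaryCompactness.
Context {R : realType}.
Local Notation C := (cplx R).

Lemma unitary_limit n (U : nat -> 'M[C]_n) L :
  (forall k, U k \is unitarymx) -> cvMx U L -> L \is unitarymx.
Proof.
move=> Uu UL; apply/unitarymxP.
apply: (cvMx_unique (cvMxM UL (cvMx_adj UL))).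
rewrite (_ : (fun k => _) = fun=> 1%:M); first exact: cvMx_cst.
by apply/funext => k; apply/unitarymxP.
Qed.

(** Compactness of a product of unitary groups and of a cube. *)
Lemma unitary_subsequence n (I T : finType) (U : nat -> I -> 'M[C]_n)
    (u : nat -> T -> R) :
  (forall k i, U k i \is unitarymx) -> (forall k t, `|u k t| <= 1) ->
  exists (f : nat -> nat) (L : I -> 'M[C]_n) (v : T -> R),
  [/\ forall k, (k <= f k)%N, forall i, L i \is unitarymx,
      forall i, cvMx (fun k => U (f k) i) (L i) &
      forall t, tends (fun k => u (f k) t) (v t)].
Proof.
move=> Uu u1.
pose x k (t : (I * ('I_n * 'I_n)) + (I * ('I_n * 'I_n)) + T) : R :=
  match t with
  | inl (inl (i, (a, b))) => re (U k i a b)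
  | inl (inr (i, (a, b))) => im (U k i a b)
  | inr t => u k t
  end.
have [|f [l [kf fl]]] := @bounded_subsequence R _ x 1.
  move=> k [[[i [a b]]|[i [a b]]]|t] //=.
    exact/sqn_le1_re/unitary_entry_sqn.
  exact/sqn_le1_im/unitary_entry_sqn.
pose L i : 'M[C]_n := \matrix_(a, b)
  (toC (l (inl (inl (i, (a, b))))) + 'i * toC (l (inl (inr (i, (a, b)))))).
have UL i : cvMx (fun k => U (f k) i) (L i).
  move=> a b; rewrite mxE; split.
    have -> : forall y z : R, re (toC y + 'i * toC z) = y.
      move=> y z; apply: toC_inj.
      by rewrite toC_re Re_rect ?toC_real.
    exact: fl (inl (inl (i, (a, b)))).
  have -> : forall y z : R, im (toC y + 'i * toC z) = z.
    move=> y z; apply: toC_inj.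
    by rewrite toC_im Im_rect ?toC_real.
  exact: fl (inl (inr (i, (a, b)))).
exists f, L, (fun t => l (inr t)); split=> //.
  by move=> i; apply: unitary_limit (UL i) => k.
by move=> t; exact: fl (inr t).
Qed.

End UnitaryCompactness.

Section Coercivity.
Context {R : realType}.
Local Notation C := (cplx R).
Context {n : nat} {I : finType} (X : I -> 'M[C]_n) (w : I -> nat -> R).
Hypothesis X_unit : forall i, X i \in unitmx.
Hypothesis w_last : forall i, w i n = 0.
Hypothesis w_decr : forall i k, (k.+1 < n)%N -> w i k.+1 <= w i k.

Definition norm1 (l : 'I_n -> R) : R := \sum_j `|l j|.

Lemma norm1_ge (l : 'I_n -> R) j : `|l j| <= norm1 l.
Proof. by rewrite /norm1 (bigD1 j) //= lerDl sumr_ge0. Qed.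

Lemma norm1_ge0 (l : 'I_n -> R) : 0 <= norm1 l.
Proof. by rewrite sumr_ge0. Qed.

(** A sequence along which the lower bound fails would, by compactness of the
    directions and convexity along rays, produce a ray along which the function
    decreases linearly, against [semistable_ray]. *)
Lemma semistable_coercive : semistable X w -> forall e, 0 < e ->
  exists c, forall U l, U \is unitarymx ->
    - c - e * norm1 l <= kempf_ness X w (ray U l 1).
Proof.
move=> ss e e0; set k0 := kempf_ness X w 1%:M.
apply: contrapT => neg.
have ex (m : nat) : exists Ul : 'M[C]_n * ('I_n -> R),
    Ul.1 \is unitarymx /\ kempf_ness X w (ray Ul.1 Ul.2 1) < - m%:R - e * norm1 Ul.2.
  apply: contrapT => h; apply: neg; exists m%:R => U l Uu.
  by rewrite leNgt; apply/negP => lt; apply: h; exists (U, l).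
have /choice[Ul hUl] := ex.
pose U m := (Ul m).1; pose l m := (Ul m).2.
pose N m := norm1 (l m).
have N0 m : 0 <= N m by exact: norm1_ge0.
pose B := frob2 (moment X w 1%:M) + n%:R + 1.
have B0 : 0 < B.
  by rewrite /B -addrA ltr_wpDl ?frob2_ge0 // ltr_wpDl.
(* The lengths [N m] tend to infinity, as the tangent plane at [1] bounds the
   function below linearly. *)
have NB m : k0 + m%:R <= N m * B.
  have [Uu lt] := hUl m.
  have := kn_ge_near_balanced X_unit w_decr Uu ltr01 (norm1_ge (l m)).
  have -> : (Ul m).1^t* *m rdiag (fun j => expR (l m j)) = ray (U m) (l m) 1.
    by rewrite /ray; congr (_ *m rdiag _); apply/funext => j; rewrite mul1r.
  move=> /le_trans /(_ (ltW lt)); rewrite invr1 mulr1 mul1r -/k0 -!/(N m).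
  have : 0 <= e * N m by rewrite mulr_ge0 // ltW.
  have := N0 m; rewrite /B; lra.
pose u m j := l m j / N m.
have u1 m j : `|u m j| <= 1.
  have [e0'|Nn0] := eqVneq (N m) 0; first by rewrite /u e0' invr0 mulr0 normr0.
  have Np : 0 < N m by rewrite lt_neqAle eq_sym Nn0 N0.
  by rewrite normrM normfV (gtr0_norm Np) ler_pdivrMr // mul1r norm1_ge.
have [f [L [v [kf Lu UL uv]]]] := @unitary_subsequence R n unit _
   (fun k _ => U k) u (fun k _ => (hUl k).1) u1.
(* The limiting direction [v] inherits the decrease at rate [e] by convexity:
   at a fixed distance [s], the chord ends at the distance [N m] >= [s + 1]. *)
have decr s : 0 <= s -> kempf_ness X w (ray (L tt) v s) <= k0 - e * s.
  move=> s0; have h : tends _ (kempf_ness X w (ray (L tt) v s)) :=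
    tends_kn_ray X_unit (Lu tt) (UL tt) uv.
  apply: tends_le h _.
  have [M hM] : exists M : nat, (s + 1) * B + `|k0| < M%:R.
    by eexists; exact: Num.Theory.truncnS_gt.
  exists M => k Mk; set m := f k.
  have hm : (s + 1) * B + `|k0| < m%:R.
    by apply: lt_le_trans hM _; rewrite ler_nat (leq_trans Mk) ?kf.
  have k0n : - `|k0| <= k0 by rewrite lerNnormlW.
  have sB : 0 <= (s + 1) * B by apply: mulr_ge0; [lra|exact: ltW].
  have Ns : s + 1 <= N m.
    by rewrite -(ler_pM2r B0); apply: le_trans (NB m); lra.
  have Np : 0 < N m by lra.
  have sN : 0 <= s <= N m by rewrite s0; lra.
  have [Uu lt] := hUl m.
  have := kn_chord X_unit w_decr (u m) Uu sN.
  have -> : ray (Ul m).1 (u m) (N m) = ray (U m) (l m) 1.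
    rewrite /ray; congr (_ *m rdiag _); apply/funext => j.
    by rewrite mul1r /u mulrC divfK // gt_eqF.
  rewrite -/(U m) -/k0 => chord; rewrite -(ler_pM2l Np).
  apply: (le_trans chord).
  have ltN : kempf_ness X w (ray (U m) (l m) 1) <= k0 - e * N m.
    apply: (le_trans (ltW lt)); rewrite lerD2r lerNl; apply: ltW.
    apply: le_lt_trans hm; rewrite -[leLHS]add0r; apply: lerD sB _.
    by rewrite -normrN ler_norm.
  have -> : N m * (k0 - e * s) = (N m - s) * k0 + s * (k0 - e * N m) by ring.
  by rewrite lerD2l ler_wpM2l.
have [c hc] := semistable_ray X_unit w_last w_decr v ss (Lu tt).
have := le_trans (hc 0 (lexx 0)) (decr 0 (lexx 0)); rewrite mulr0 subr0 => ck.
have s0 : 0 <= (k0 - c + 1) / e by rewrite divr_ge0 ?(ltW e0) //; lra.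
have := le_trans (hc _ s0) (decr _ s0); rewrite mulrC divfK ?gt_eqF //.
by lra.
Qed.

End Coercivity.

(** * Almost balanced real positions *)

Section Balancing.
Context {R : realType}.
Local Notation C := (cplx R).

Lemma frob2_mulr_unitary m n (A : 'M[C]_(m, n)) (V : 'M[C]_n) : V \is unitarymx ->
  frob2 (A *m V) = frob2 A.
Proof.
move=> Vu; apply: toC_inj; rewrite !frob2E adjmxM mulmxA -(mulmxA A).
by rewrite (unitarymxP Vu) mulmx1.
Qed.

Lemma frob2_adj m n (A : 'M[C]_(m, n)) : frob2 (A^t* : 'M_(n, m)) = frob2 A.
Proof. by apply: toC_inj; rewrite !frob2E adjmxK mxtrace_mulC. Qed.

Lemma frob2_mulr_rdiag_le m n (A : 'M[C]_(m, n)) (f : 'I_n -> R) M :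
  (forall j, f j ^+ 2 <= M) -> frob2 (A *m rdiag f) <= M * frob2 A.
Proof.
move=> fM; rewrite mulr_sumr; apply: ler_sum => i _.
rewrite mulr_sumr; apply: ler_sum => j _.
by rewrite mul_mx_diag !mxE sqnM sqn_real mulrC ler_wpM2r ?sqn_ge0.
Qed.

Lemma frob2_rdiag n (f : 'I_n -> R) : frob2 (rdiag f) = \sum_j f j ^+ 2.
Proof.
apply: eq_bigr => i _; rewrite (bigD1 i) //= big1 => [|j ji].
  by rewrite !mxE eqxx mulr1n addr0 sqn_real.
by rewrite !mxE eq_sym (negPf ji) mulr0n; apply/eqP; rewrite sqn_eq0.
Qed.

Lemma rdiag0 n : rdiag (fun=> 0) = 0 :> 'M[C]_n.
Proof. by apply/matrixP => i j; rewrite !mxE mul0rn. Qed.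

Lemma frob2D m n (A B : 'M[C]_(m, n)) :
  frob2 (A + B) <= 2 * frob2 A + 2 * frob2 B.
Proof.
rewrite !mulr_sumr -big_split; apply: ler_sum => i _ /=.
rewrite !mulr_sumr -big_split; apply: ler_sum => j _ /=.
rewrite mxE /sqn raddfD imD /=.
set a := re _; set b := re _; set c := im _; set d := im _.
rewrite -subr_ge0.
have -> : 2 * (a ^+ 2 + c ^+ 2) + 2 * (b ^+ 2 + d ^+ 2)
    - ((a + b) ^+ 2 + (c + d) ^+ 2) = (a - b) ^+ 2 + (c - d) ^+ 2 by ring.
by rewrite addr_ge0 ?sqr_ge0.
Qed.

Lemma frob2_eq0 m n (A : 'M[C]_(m, n)) : frob2 A = 0 -> A = 0.
Proof.
move=> A0; apply/matrixP => i j; rewrite mxE; apply/eqP; rewrite -sqn_eq0.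
have ge0 k : 0 <= \sum_j sqn (A k j) by apply: sumr_ge0 => *; exact: sqn_ge0.
have /psumr_eq0P/(_ A0)/(_ i isT)/psumr_eq0P := fun k (_ : true) => ge0 k.
by move=> -> // *; exact: sqn_ge0.
Qed.

Lemma frob2_unit_gt0 n (g : 'M[C]_n) : (0 < n)%N -> g \in unitmx ->
  0 < frob2 g.
Proof.
move=> n0 gu; rewrite lt_neqAle frob2_ge0 andbT.
apply/negP => /eqP/esym/frob2_eq0 g0.
have := mulmxV gu; rewrite g0 mul0mx => /matrixP/(_ (Ordinal n0) (Ordinal n0)).
by rewrite !mxE eqxx => /eqP; rewrite eq_sym oner_eq0.
Qed.

Lemma frob2_congr_rdiag_le m n (A : 'M[C]_(m, n)) V (f : 'I_n -> R) M :
  V \is unitarymx -> (forall j, f j ^+ 2 <= M) ->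
  frob2 (A *m (V^t* *m rdiag f *m V)) <= M * frob2 A.
Proof.
move=> Vu fM; rewrite !mulmxA frob2_mulr_unitary //.
rewrite -(frob2_mulr_unitary A (adj_unitary Vu)).
exact: frob2_mulr_rdiag_le.
Qed.

Lemma invmx_congr_rdiag n (V : 'M[C]_n) (f : 'I_n -> R) : V \is unitarymx ->
  (forall j, f j != 0) ->
  invmx (V^t* *m rdiag f *m V) = V^t* *m rdiag (fun j => (f j)^-1) *m V.
Proof.
move=> Vu f0.
have hu : V^t* *m rdiag f *m V \in unitmx.
  by rewrite !unitmx_mul adj_unit unitarymx_unit ?rdiag_unit.
apply: (can_inj (mulKmx hu)); rewrite mulmxV // !mulmxA.
rewrite -(mulmxA _ V (V^t*)) (unitarymxP Vu) mulmx1 -(mulmxA (V^t*)) rdiagM.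
rewrite (_ : (fun j => _ * _) = fun=> 1) ?rdiag1 ?mulmx1 ?unitary_adjK //.
by apply/funext => j; rewrite mulfV.
Qed.

Lemma near_infimum (T : Type) (P : T -> Prop) (f : T -> R) c e :
  (exists x, P x) -> (forall x, P x -> c <= f x) -> 0 < e ->
  exists2 x, P x & forall y, P y -> f x <= f y + e.
Proof.
move=> [x0 Px0] fc e0; pose E := [set f x | x in [set x | P x]]%classic.
have Ei : has_inf E.
  by split; [exists (f x0), x0|exists c => _ [x Px <-]; exact: fc].
have [_ [x Px <-] lt] := inf_adherent e0 Ei.
exists x => // y Py; apply: (le_trans (ltW lt)); rewrite lerD2r.
by apply: inf_lbound; [case: Ei|exists y].
Qed.

Lemma ln_1B_le (x : R) : x < 1 -> ln (1 - x) <= - x.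
Proof. by move=> x1; apply: le_ln1Dx; lra. Qed.

Lemma ln_1B_ge (x : R) : `|x| <= 1 / 2 -> - x - 2 * x ^+ 2 <= ln (1 - x).
Proof.
rewrite ler_norml => /andP[xl xr].
have p : 0 < 1 - x by lra.
rewrite -lerN2 -lnV ?posrE //.
have -> : (1 - x)^-1 = 1 + x / (1 - x) by field; rewrite gt_eqF.
apply: le_trans (_ : x / (1 - x) <= _).
  apply: le_ln1Dx; rewrite ltr_pdivlMr //; lra.
rewrite ler_pdivrMr // -subr_ge0.
have -> : - (- x - 2 * x ^+ 2) * (1 - x) - x = x ^+ 2 * (1 - 2 * x) by ring.
by rewrite mulr_ge0 ?sqr_ge0 //; lra.
Qed.

(** The bookkeeping of one step of length [s] at an almost minimal point. *)
Lemma descent_bound (e W c0 s eps F k1 k2 L1 L2 : R) :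
  0 < s -> 0 <= F -> s <= e / 2 -> eps * c0 = e / 16 -> 10 * (s * W) <= 1 ->
  k1 + eps * L1 <= k2 + eps * L2 + s ^+ 2 ->
  k2 <= k1 - (3 / 2 * s - 5 * W * s ^+ 2) * F ->
  eps * L2 <= eps * (L1 + 4 * (s * c0)) -> F <= e.
Proof.
move=> s0 F0 se epsc sW m1 m2 m3.
have sWF : 5 * W * s ^+ 2 * F <= 1 / 2 * s * F.
  rewrite ler_wpM2r // expr2 mulrA ler_wpM2r ?(ltW s0) //.
  by lra.
have e0 : eps * (4 * (s * c0)) = s * (e / 4).
  have -> : eps * (4 * (s * c0)) = 4 * s * (eps * c0) by ring.
  by rewrite epsc; field.
have fin : s * F <= s * (e / 4 + s).
  rewrite [leRHS]mulrDr -expr2 -e0.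
  rewrite mulrDr in m3; rewrite mulrBl in m2; lra.
by move: fin; rewrite ler_pM2l //; lra.
Qed.

Section Fixed.
Context {n : nat} {I : finType} (X : I -> 'M[C]_n) (w : I -> nat -> R).
Hypothesis X_unit : forall i, X i \in unitmx.
Hypothesis w_last : forall i, w i n = 0.
Hypothesis w_decr : forall i k, (k.+1 < n)%N -> w i k.+1 <= w i k.

(** A logarithmic distance from [g] to the unitary group, which changes at a
    bounded rate under multiplication. A small multiple of it, added to the
    Kempf-Ness function, makes the sum bounded below. *)
Definition lognorm (g : 'M[C]_n) : R := ln (frob2 g + frob2 (invmx g)).

Lemma norm1_le_lognorm (g U : 'M[C]_n) (l : 'I_n -> R) : g \in unitmx ->
  U \is unitarymx ->
  g *m g^t* = U^t* *m rdiag (fun i => expR (2 * l i)) *m U ->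
  2 * norm1 l <= n%:R * lognorm g.
Proof.
move=> gu Uu e.
have fg : frob2 g = \sum_j expR (2 * l j).
  apply: toC_inj; rewrite frob2E e mxtrace_mulC mulmxA (unitarymxP Uu) mul1mx.
  by rewrite mxtrace_diag rmorph_sum; apply: eq_bigr => j _; rewrite mxE.
have fi : frob2 (invmx g) = \sum_j expR (- (2 * l j)).
  apply: toC_inj; rewrite frob2E mxtrace_mulC adj_inv.
  have -> : invmx (g^t*) *m invmx g = invmx (g *m g^t*).
    have gg : g *m g^t* \in unitmx by rewrite unitmx_mul gu adj_unit.
    apply: (can_inj (mulKmx gg)); rewrite mulmxV // !mulmxA mulmxK ?adj_unit //.
    by rewrite mulmxV.
  rewrite e invmx_congr_rdiag //; last by move=> j; rewrite gt_eqF ?expR_gt0.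
  rewrite (_ : (fun j => _) = (fun j => expR (- (2 * l j)))); last first.
    by apply/funext => j; rewrite expRN.
  rewrite mxtrace_mulC mulmxA (unitarymxP Uu) mul1mx mxtrace_diag rmorph_sum.
  by apply: eq_bigr => j _; rewrite mxE.
have -> : n%:R * lognorm g = \sum_(j < n) lognorm g.
  by rewrite sumr_const card_ord mulr_natl.
rewrite /norm1 mulr_sumr; apply: ler_sum => j _; rewrite /lognorm fg fi.
have S (f : 'I_n -> R) : expR (f j) <= \sum_j expR (f j).
  by rewrite (bigD1 j) //= lerDl sumr_ge0 // => *; exact: expR_ge0.
have pos (f : 'I_n -> R) : 0 <= \sum_j expR (f j).
  by rewrite sumr_ge0 // => *; exact: expR_ge0.
set a := \sum_j _; set b := \sum_j _.
have a0 : 0 < a by apply: lt_le_trans (S (fun j => 2 * l j)); exact: expR_gt0.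
have b0 : 0 <= b by exact: pos.
rewrite -ler_expR lnK ?posrE ?ltr_pwDl //.
have [l0|l0] := leP 0 (l j).
  rewrite ger0_norm // -[leLHS]addr0.
  exact: lerD (S (fun j => 2 * l j)) b0.
rewrite ltr0_norm // mulrN -[leLHS]add0r.
exact: lerD (ltW a0) (S (fun j => - (2 * l j))).
Qed.

(** Coercivity, moved from rays to all invertible matrices by polar
    decomposition. *)
Lemma kn_ge_lognorm : semistable X w -> forall e, 0 < e ->
  exists c, forall g, g \in unitmx -> - c - e * lognorm g <= kempf_ness X w g.
Proof.
move=> ss e e0; have en : 0 < 2 * e / n.+1%:R.
  by rewrite divr_gt0 ?mulr_gt0 // ltr0n.
have [c hc] := semistable_coercive X_unit w_last w_decr ss en.
exists c => g gu; have [U [l [Uu eg]]] := unitary_polar gu.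
have -> : kempf_ness X w g = kempf_ness X w (ray U l 1).
  apply: kn_eq_of_gram; rewrite eg; apply/esym; rewrite /ray adjmxM adjmxK adj_rdiag !mulmxA.
  rewrite -(mulmxA (U^t*)) rdiagM.
  rewrite (_ : (fun j => _ * _) = (fun j => expR (2 * l j))) //.
  by apply/funext => j; rewrite -expRD mul1r mulr_natl mulr2n.
apply: le_trans (hc U l Uu); rewrite lerD2l lerN2.
have h := norm1_le_lognorm gu Uu eg.
have n1 : 0 <= norm1 l by exact: norm1_ge0.
have L0 : 0 <= lognorm g.
  have [n0|n0] := posnP n; last first.
    by rewrite -(pmulr_rge0 _ (_ : 0 < n%:R)) ?ltr0n //; lra.
  rewrite /lognorm /frob2 !big1 ?addr0 ?ln0 //.
    by move=> [i ii]; exfalso; move: ii; rewrite n0.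
  by move=> [i ii]; exfalso; move: ii; rewrite n0.
rewrite mulrAC ler_pdivrMr ?ltr0n //.
have -> : 2 * e * norm1 l = e * (2 * norm1 l) by ring.
rewrite -mulrA ler_pM2l //; apply: (le_trans h).
by rewrite mulrC ler_wpM2l // ler_nat.
Qed.

Lemma moment_hermitian g : g \in unitmx -> (moment X w g)^t* = moment X w g.
Proof.
move=> gu; rewrite /moment raddf_sum raddf_sum; apply: eq_bigr => i _ /=.
have Xgu : X i *m g \in unitmx by rewrite unitmx_mul X_unit gu.
have [Q Qu ->] := flagmxP Xgu (w_last i).
by rewrite !adjmxM adjmxK adj_rdiag mulmxA.
Qed.

(** A weighted flag has the norm of its weights, whatever its position. *)
Lemma frob2_moment_bounded :
  exists B, forall g, g \in unitmx -> frob2 (moment X w g) <= B.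
Proof.
rewrite /moment; elim: (index_enum I) => [|i r [B hB]].
  exists 0 => g _; rewrite big_nil -rdiag0 frob2_rdiag.
  by rewrite big1 // => j _; rewrite expr0n.
exists (2 * (\sum_(k < n) w i k ^+ 2) + 2 * B) => g gu; rewrite big_cons.
apply: (le_trans (frob2D _ _)); apply: lerD; last by rewrite ler_wpM2l ?hB.
have Xgu : X i *m g \in unitmx by rewrite unitmx_mul X_unit gu.
have [Q Qu ->] := flagmxP Xgu (w_last i).
have := frob2_unitary_congr (rdiag (fun k : 'I_n => w i k)) (adj_unitary Qu).
by rewrite adjmxK => ->; rewrite frob2_rdiag.
Qed.

Lemma lognorm_mulr_le g V (f : 'I_n -> R) x : g \in unitmx ->
  V \is unitarymx -> 0 <= x <= 1 / 2 -> (0 < n)%N ->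
  (forall j, `|1 - f j| <= x) ->
  lognorm (g *m (V^t* *m rdiag f *m V)) <= lognorm g + 4 * x.
Proof.
move=> gu Vu /andP[x0 x1] n0 fx.
have f1 j : 1 - x <= f j <= 1 + x.
  by have := fx j; rewrite ler_distlC => /andP[]; lra.
have fp j : 0 < f j by have /andP[] := f1 j; lra.
have f0 j : f j != 0 by rewrite gt_eqF.
set h := V^t* *m rdiag f *m V.
have hu : h \in unitmx.
  by rewrite !unitmx_mul adj_unit unitarymx_unit ?rdiag_unit.
pose y := (1 - x)^-1.
have x1p : 0 < 1 - x by lra.
have y0 : 0 < y by rewrite invr_gt0.
have sq (a : R) : 0 < a -> a <= y -> a ^+ 2 <= y ^+ 2.
  by move=> a0 ay; rewrite lerXn2r ?nnegrE // ltW.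
have le1 : frob2 (g *m h) <= y ^+ 2 * frob2 g.
  apply: frob2_congr_rdiag_le => // j; apply: sq => //.
  rewrite -[y]div1r ler_pdivlMr //; have /andP[fl fr] := f1 j.
  apply: (le_trans (ler_wpM2r (ltW x1p) fr)).
  rewrite -subr_ge0 (_ : 1 - _ = x ^+ 2) ?sqr_ge0 //; ring.
have le2 : frob2 (invmx (g *m h)) <= y ^+ 2 * frob2 (invmx g).
  have -> : invmx (g *m h) = invmx h *m invmx g.
    have ghu : g *m h \in unitmx by rewrite unitmx_mul gu hu.
    apply: (can_inj (mulKmx ghu)); rewrite (mulmxV ghu) mulmxA (mulmxK hu).
    exact/esym/mulmxV.
  rewrite -frob2_adj adjmxM -(frob2_adj (invmx g)) invmx_congr_rdiag //.
  rewrite adjmxM adjmxM adjmxK adj_rdiag (mulmxA (V^t*)).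
  apply: frob2_congr_rdiag_le => // j; apply: sq; first by rewrite invr_gt0.
  by rewrite lef_pV2 ?posrE //; have /andP[] := f1 j.
have g0 := frob2_unit_gt0 n0 gu.
have s0 : 0 < frob2 g + frob2 (invmx g) by rewrite ltr_pwDl ?frob2_ge0.
have ghu : g *m h \in unitmx by rewrite unitmx_mul gu hu.
have gh0 : 0 < frob2 (g *m h) + frob2 (invmx (g *m h)).
  by rewrite ltr_pwDl ?frob2_ge0 // frob2_unit_gt0.
have lny : ln y <= 2 * x.
  have := @ln_1B_ge x; rewrite ger0_norm // => /(_ x1).
  rewrite /y lnV ?posrE // => hx.
  apply: (@le_trans _ _ (x + 2 * x ^+ 2)); first by lra.
  rewrite -subr_ge0 (_ : _ - _ = x * (1 - 2 * x)); last by ring.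
  by rewrite mulr_ge0 //; lra.
have y2 : 0 < y ^+ 2 by rewrite exprn_gt0.
rewrite /lognorm; set a := frob2 g + _ in s0 *.
apply: (@le_trans _ _ (ln (y ^+ 2 * a))).
  rewrite ler_ln ?posrE ?mulr_gt0 // /a mulrDr; exact: lerD.
by rewrite lnM ?posrE // lnXn // addrC lerD2l mulr2n; lra.
Qed.

(** One step of gradient descent. With [D] the moment, the linear term of
    [kn_variation] is [- 2 s tr D^2 + s^2 tr D^3], where the cubic part takes at
    most a quarter as [s D] is at most [1 / 2]; the number [5] comes from
    [`|2 ln (1 - x) - ((1 - x)^2 - 1)| <= 5 x^2]. *)
Lemma kn_variation_hermitian g V (d : 'I_n -> R) s : g \in unitmx ->
  V \is unitarymx -> moment X w g = V^t* *m rdiag d *m V -> 0 <= s ->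
  (forall j, s * `|d j| <= 1 / 2) ->
  kempf_ness X w (g *m (1%:M - toC s *: moment X w g)) <= kempf_ness X w g
    - (3 / 2 * s - 5 * (\sum_i \sum_(k < n) `|w i k|) * s ^+ 2)
        * frob2 (moment X w g).
Proof.
move=> gu Vu eD s0 sd; set D := moment X w g in eD *.
have VV := unitary_adjK Vu; have VV1 : V *m V^t* = 1%:M by apply/unitarymxP.
have FE : frob2 D = \sum_j d j ^+ 2.
  have := frob2_unitary_congr (rdiag d) (adj_unitary Vu).
  by rewrite adjmxK eD frob2_rdiag.
pose f j := 1 - s * d j.
have sd1 j : - (1 / 2) <= s * d j <= 1 / 2.
  by rewrite -ler_norml normrM (ger0_norm s0).
have f0 j : 0 < f j by have /andP[] := sd1 j; rewrite /f; lra.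
have hE : 1%:M - toC s *: D = V^t* *m rdiag f *m V.
  have -> : rdiag f = 1%:M - toC s *: rdiag d.
    apply/matrixP => i j; rewrite !mxE /f rmorphB rmorphM mulrnBl rmorph1.
    by rewrite mulrnAr.
  rewrite mulmxBr mulmx1 mulmxBl VV -scalemxAr -scalemxAl.
  by rewrite eD.
have fu : V^t* *m rdiag f *m V \in unitmx.
  by rewrite !unitmx_mul adj_unit unitarymx_unit ?rdiag_unit // => j;
     rewrite gt_eqF.
rewrite hE; apply: (le_trans (kn_variation X_unit w_last w_decr gu fu)).
rewrite -/D.
have hh : (V^t* *m rdiag f *m V) *m (V^t* *m rdiag f *m V)^t* - 1%:M =
    V^t* *m rdiag (fun j => f j ^+ 2 - 1) *m V.
  have -> : rdiag (fun j => f j ^+ 2 - 1) = rdiag f *m rdiag f - 1%:M.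
    rewrite rdiagM; apply/matrixP => i j; rewrite !mxE rmorphB mulrnBl rmorph1.
    by rewrite expr2.
  rewrite mulmxBr mulmx1 mulmxBl VV; congr (_ - _).
  rewrite !adjmxM adjmxK adj_rdiag -!mulmxA (mulmxA V).
  by rewrite VV1 mul1mx.
rewrite hh eD.
have -> : re (\tr (V^t* *m rdiag d *m V *m
                    (V^t* *m rdiag (fun j => f j ^+ 2 - 1) *m V)))
    = \sum_j d j * (f j ^+ 2 - 1).
  rewrite !mulmxA -(mulmxA _ V (V^t*)) VV1 mulmx1 mxtrace_mulC.
  rewrite !mulmxA VV1 mul1mx rdiagM mxtrace_diag re_sum.
  by apply: eq_bigr => j _; rewrite mxE.
have -> : re (\tr (V^t* *m rdiag (fun j => f j ^+ 2 - 1) *m V))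
    = \sum_j (f j ^+ 2 - 1).
  rewrite mxtrace_mulC !mulmxA VV1 mul1mx mxtrace_diag re_sum.
  by apply: eq_bigr => j _; rewrite mxE.
rewrite det_unitary_congr // det_rdiag sqn_real.
rewrite -eD FE.
have -> : ln ((\prod_j f j) ^+ 2) = \sum_j 2 * ln (f j).
  have p0 : 0 < \prod_j f j by apply: prodr_gt0.
  rewrite lnXn // -mulr_sumr mulr_natl; congr (_ *+ _).
  apply: expR_inj; rewrite lnK ?posrE // expR_sum.
  by apply: eq_bigr => j _; rewrite lnK ?posrE.
rewrite -sumrB mulrBl opprB -addrA lerD2l.
have h1 : \sum_j d j * (f j ^+ 2 - 1) <= - (3 / 2 * s * \sum_j d j ^+ 2).
  rewrite mulr_sumr -sumrN; apply: ler_sum => j _.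
  rewrite -subr_ge0 /f.
  have -> : - (3 / 2 * s * d j ^+ 2) - d j * ((1 - s * d j) ^+ 2 - 1) =
     s * d j ^+ 2 * (1 / 2 - s * d j) by field.
  apply: mulr_ge0; first by rewrite mulr_ge0 ?sqr_ge0.
  by rewrite subr_ge0; have /andP[] := sd1 j.
have h2 : `|\sum_j (2 * ln (f j) - (f j ^+ 2 - 1))|
    <= 5 * s ^+ 2 * \sum_j d j ^+ 2.
  apply: (le_trans (ler_norm_sum _ _ _)); rewrite mulr_sumr.
  apply: ler_sum => j _; set x := s * d j.
  have -> : 5 * s ^+ 2 * d j ^+ 2 = 5 * x ^+ 2 by rewrite /x; ring.
  have xs : `|x| <= 1 / 2 by rewrite ler_norml sd1.
  have lo := ln_1B_ge xs.
  have x1 : x < 1 by have /andP[] := sd1 j; rewrite -/x; lra.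
  have up := ln_1B_le x1.
  have x2 := sqr_ge0 x.
  have -> : f j ^+ 2 - 1 = x ^+ 2 - 2 * x by rewrite /f -/x; ring.
  rewrite /f -/x; move: (ln _) (x ^+ 2) lo up x2 => a b lo up x2.
  by rewrite ler_norml; apply/andP; split; lra.
set W := \sum_i \sum_(k < n) _.
have W0 : 0 <= W by do 2![apply: sumr_ge0 => ? _].
have h3 := ler_wpM2l W0 h2.
have -> : 5 * W * s ^+ 2 * \sum_j d j ^+ 2 = W * (5 * s ^+ 2 * \sum_j d j ^+ 2).
  by ring.
by rewrite addrC; exact: lerD h3 h1.
Qed.

Hypothesis n_gt0 : (0 < n)%N.

Definition isreal m p (A : 'M[C]_(m, p)) := map_mx conjC A = A.

Lemma moment_real g : (forall i, isreal (X i)) -> isreal g ->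
  isreal (moment X w g).
Proof.
move=> Xr gr; rewrite /isreal /moment raddf_sum; apply: eq_bigr => i _ /=.
by rewrite -flagmx_conj map_mxM Xr gr.
Qed.

(** The real matrices are invariant under gradient descent, since the moment of
    real flags at a real [g] is real. Hence an almost minimal point among the
    real [g] has a small gradient in all directions, not only the real ones. *)
Lemma semistable_near_balanced : (forall i, isreal (X i)) -> semistable X w ->
  forall e : R, 0 < e -> exists g,
    [/\ g \in unitmx, isreal g & frob2 (moment X w g) <= e].
Proof.
move=> Xr ss e e0.
have [B hB] := frob2_moment_bounded.
have B0 : 0 <= B by apply: le_trans (hB 1%:M (unitmx1 _ _)); exact: frob2_ge0.
pose W : R := \sum_i \sum_(k < n) `|w i k|.
have W0 : 0 <= W by do 2![apply: sumr_ge0 => ? _].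
(* [c0] bounds the eigenvalues of every moment; the step length [s] is the
   inverse of a sum of the reciprocals of all the bounds it has to satisfy. *)
pose c0 : R := B + 1; have c1 : 1 <= c0 by rewrite /c0; lra.
pose q : R := 2 / e + 10 * W + 2 * c0.
have e2 : 0 < 2 / e by rewrite divr_gt0.
have q0 : 0 < q by rewrite /q; lra.
pose s : R := q^-1; have s0 : 0 < s by rewrite invr_gt0.
have sq : s * (2 / e) + 10 * (s * W) + 2 * (s * c0) = 1.
  transitivity (s * q); first by rewrite /q; ring.
  by rewrite mulVf // gt_eqF.
have [t1 t2 t3] : [/\ 0 <= s * (2 / e), 0 <= s * W & 0 <= s * c0].
  by rewrite !mulr_ge0 ?(ltW s0) ?(ltW e2) //; lra.
have se : s <= e / 2.
  by rewrite ler_pdivlMr // -(@ler_pM2r _ e^-1) ?invr_gt0 // mulfV ?gt_eqF //; lra.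
pose eps : R := e / (16 * c0).
have eps0 : 0 < eps by rewrite divr_gt0 //; lra.
have epsc : eps * c0 = e / 16 by rewrite /eps; field; rewrite gt_eqF //; lra.
have xr : 0 <= s * c0 <= 1 / 2 by rewrite t3; lra.
have sW : 10 * (s * W) <= 1 by lra.
(* The infimum is approached to within [s ^+ 2], the order of the error of one
   descent step. *)
have [c hc] := kn_ge_lognorm ss eps0.
have [|||g [gu gr] gmin] := @near_infimum _ (fun g => g \in unitmx /\ isreal g)
  (fun g => kempf_ness X w g + eps * lognorm g) (- c) (s ^+ 2).
- by exists 1%:M; split; [exact: unitmx1|rewrite /isreal map_mx1].
- by move=> g [gu _]; have := hc g gu; lra.
- by rewrite exprn_gt0.
exists g; split; [exact: gu|exact: gr|].
set D := moment X w g; set F := frob2 D.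
have [V [d [Vu eD]]] := hermitian_diag (moment_hermitian gu).
have FE : F = \sum_j d j ^+ 2.
  have := frob2_unitary_congr (rdiag d) (adj_unitary Vu).
  by rewrite adjmxK -eD frob2_rdiag.
have dc j : `|d j| <= c0.
  rewrite -(@ler_pXn2r _ 2) ?nnegrE // ?real_normK ?num_real //; last by lra.
  apply: (@le_trans _ _ F).
    by rewrite FE (bigD1 j) //= lerDl sumr_ge0 // => *; exact: sqr_ge0.
  apply: (le_trans (hB g gu)); rewrite /c0 -subr_ge0.
  rewrite (_ : _ - B = B ^+ 2 + B + 1); last by ring.
  by have := sqr_ge0 B; lra.
have sd j : s * `|d j| <= s * c0 by rewrite ler_pM2l.
have sd2 j : s * `|d j| <= 1 / 2 by apply: (le_trans (sd j)); lra.
pose h := 1%:M - toC s *: D.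
have hE : h = V^t* *m rdiag (fun j => 1 - s * d j) *m V.
  have -> : rdiag (fun j => 1 - s * d j) = 1%:M - toC s *: rdiag d.
    apply/matrixP => i j; rewrite !mxE rmorphB rmorphM mulrnBl rmorph1.
    by rewrite mulrnAr.
  rewrite mulmxBr mulmx1 mulmxBl (unitary_adjK Vu) -scalemxAr -scalemxAl.
  by rewrite /h /D eD.
have hu : h \in unitmx.
  rewrite hE !unitmx_mul adj_unit unitarymx_unit ?rdiag_unit // => j.
  have sj : s * d j <= 1 / 2.
    by apply: le_trans (sd2 j); rewrite ler_pM2l // ler_norm.
  by rewrite gt_eqF // subr_gt0; apply: (le_lt_trans sj); lra.
have hr : isreal h.
  rewrite /isreal /h map_mxB map_mx1 map_mxZ (moment_real Xr gr).
  by rewrite /= conj_toC.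
have ghP : g *m h \in unitmx /\ isreal (g *m h).
  by split; [rewrite unitmx_mul gu hu|rewrite /isreal map_mxM gr hr].
have m1 := gmin _ ghP.
have m2 := kn_variation_hermitian gu Vu eD (ltW s0) sd2.
have m3 : lognorm (g *m h) <= lognorm g + 4 * (s * c0).
  have fx j : `|1 - (1 - s * d j)| <= s * c0.
    by rewrite opprB addrC subrK normrM (ger0_norm (ltW s0)).
  by rewrite hE; exact: lognorm_mulr_le gu Vu xr n_gt0 fx.
rewrite -/D -/F -/W -/h in m2.
exact: descent_bound s0 (frob2_ge0 D) se epsc sW m1 m2 (ler_wpM2l (ltW eps0) m3).
Qed.

End Fixed.
End Balancing.

(** * Real balanced spectra from semistable real flags *)

Section RealLimit.
Context {R : realType}.
Local Notation C := (cplx R).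
Context {n : nat} {I : finType} (X : I -> 'M[C]_n) (w : I -> nat -> R).
Hypothesis X_unit : forall i, X i \in unitmx.
Hypothesis w_last : forall i, w i n = 0.
Hypothesis w_decr : forall i k, (k.+1 < n)%N -> w i k.+1 <= w i k.
Hypothesis n_gt0 : (0 < n)%N.
Hypothesis X_real : forall i, isreal (X i).

Definition with_spectrum (Q : 'M[C]_n) (f : nat -> R) : 'M[C]_n :=
  Q^t* *m rdiag (fun k : 'I_n => f k) *m Q.

(** The positions [g] along which the moment tends to 0 may diverge, but the
    weighted flags themselves stay in a product of orbits of the unitary group,
    which is compact. *)
Lemma semistable_real_balanced : semistable X w ->
  exists Q : I -> 'M[C]_n, [/\ forall i, Q i \is unitarymx,
    forall i, isreal (with_spectrum (Q i) (w i)) &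
    \sum_i with_spectrum (Q i) (w i) = 0].
Proof.
move=> ss.
have ex (m : nat) : exists g, [/\ g \in unitmx, isreal g &
    frob2 (moment X w g) <= m.+1%:R^-1].
  by apply: semistable_near_balanced => //; rewrite invr_gt0 ltr0n.
have /choice[g hg] := ex.
have /choice[Q hQ] : forall m, exists Q : I -> 'M[C]_n, forall i,
    Q i \is unitarymx /\ flagmx (X i *m g m) (w i) = with_spectrum (Q i) (w i).
  move=> m; have [gu _ _] := hg m.
  have /choice[q hq] : forall i, exists q,
      q \is unitarymx /\ flagmx (X i *m g m) (w i) = with_spectrum q (w i).
    move=> i; have Xgu : X i *m g m \in unitmx by rewrite unitmx_mul X_unit gu.
    by have [q qu e] := flagmxP Xgu (w_last i); exists q.
  by exists q.
have [|f [L [_ [kf Lu QL _]]]] := @unitary_subsequence R n I void Q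
   (fun _ _ => 0) (fun m i => (hQ m i).1).
  by move=> k [].
have SL i : cvMx (fun k => flagmx (X i *m g (f k)) (w i))
                 (with_spectrum (L i) (w i)).
  rewrite (_ : (fun k => _) = (fun k => with_spectrum (Q (f k) i) (w i))).
    apply: cvMxM => //; apply: cvMxM; first exact: cvMx_adj.
    exact: cvMx_cst.
  by apply/funext => k; have [] := hQ (f k) i.
exists L; split => // [i|].
  apply: (cvMx_unique _ (SL i)) => a b.
  rewrite mxE; rewrite (_ : (fun k => _) =
     (fun k => (flagmx (X i *m g (f k)) (w i) a b)^*)).
    exact: cvC_conj (SL i a b).
  apply/funext => k; have [_ gr _] := hg (f k).
  have : isreal (flagmx (X i *m g (f k)) (w i)).
    by rewrite /isreal -flagmx_conj map_mxM X_real gr.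
  by move=> {1}<-; rewrite mxE.
have sumL : cvMx (fun k => moment X w (g (f k)))
    (\sum_i with_spectrum (L i) (w i)) by exact: cvMx_sum.
apply: frob2_eq0; apply/eqP; rewrite eq_le frob2_ge0 andbT.
rewrite leNgt; apply/negP => pos.
set F := frob2 _ in pos.
have [N hN] : exists N : nat, F^-1 < N.+1%:R.
  by eexists; exact: Num.Theory.truncnS_gt.
have : F <= N.+2%:R^-1.
  apply: (tends_le (tends_frob2 sumL)); exists N.+1 => k Nk.
  have [_ _ h] := hg (f k); apply: (le_trans h).
  by rewrite lef_pV2 ?posrE ?ltr0n // ler_nat !ltnS (leq_trans Nk).
rewrite leNgt => /negP; apply.
rewrite -[ltRHS]invrK ltf_pV2 ?posrE ?invr_gt0 ?ltr0n //.
by apply: (lt_trans hN); rewrite ltr_nat.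
Qed.

End RealLimit.

(** * Systems of polynomial equations with one parameter *)

Section Constructible.
Variable F : closedFieldType.

Lemma rterm_poly (t : GRing.term F) : GRing.rterm t ->
  exists p : {poly F}, forall x, GRing.eval [:: x] t = p.[x].
Proof.
elim: t => //=.
- move=> [|i] _; first by exists 'X => x; rewrite hornerX.
  by exists 0 => x; rewrite horner0; case: i.
- by move=> a _; exists a%:P => x; rewrite hornerC.
- by move=> m _; exists (m%:R)%:P => x; rewrite hornerC.
- move=> t1 IH1 t2 IH2 /andP[/IH1[p1 h1] /IH2[p2 h2]].
  by exists (p1 + p2) => x; rewrite hornerD h1 h2.
- by move=> t IH /IH[p h]; exists (- p) => x; rewrite hornerN h.
- by move=> t IH m /IH[p h]; exists (p *+ m) => x; rewrite hornerMn h.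
- move=> t1 IH1 t2 IH2 /andP[/IH1[p1 h1] /IH2[p2 h2]].
  by exists (p1 * p2) => x; rewrite hornerM h1 h2.
- by move=> t IH m /IH[p h]; exists (p ^+ m) => x; rewrite horner_exp h.
Qed.

Lemma qf_generic (f : GRing.formula F) : GRing.qf_form f -> GRing.rformula f ->
  exists (p : {poly F}) (b : bool), p != 0 /\
    forall x, p.[x] != 0 -> GRing.qf_eval [:: x] f = b.
Proof.
elim: f => //=.
- by move=> b _ _; exists 1, b; split; first exact: oner_neq0.
- move=> t1 t2 _ /andP[/rterm_poly[p1 h1] /rterm_poly[p2 h2]].
  have [p12|p12] := eqVneq p1 p2.
    by exists 1, true; split=> [|x _]; rewrite ?oner_neq0 // h1 h2 p12 eqxx.
  exists (p1 - p2), false; split=> [|x]; first by rewrite subr_eq0.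
  by rewrite hornerD hornerN subr_eq0 h1 h2 => /negPf.
- move=> f1 IH1 f2 IH2 /andP[q1 q2] /andP[r1 r2].
  have [p1 [b1 [n1 h1]]] := IH1 q1 r1; have [p2 [b2 [n2 h2]]] := IH2 q2 r2.
  exists (p1 * p2), (b1 && b2); split=> [|x]; first by rewrite mulf_neq0.
  by rewrite hornerM mulf_eq0 negb_or => /andP[/h1-> /h2->].
- move=> f1 IH1 f2 IH2 /andP[q1 q2] /andP[r1 r2].
  have [p1 [b1 [n1 h1]]] := IH1 q1 r1; have [p2 [b2 [n2 h2]]] := IH2 q2 r2.
  exists (p1 * p2), (b1 || b2); split=> [|x]; first by rewrite mulf_neq0.
  by rewrite hornerM mulf_eq0 negb_or => /andP[/h1-> /h2->].
- move=> f1 IH1 f2 IH2 /andP[q1 q2] /andP[r1 r2].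
  have [p1 [b1 [n1 h1]]] := IH1 q1 r1; have [p2 [b2 [n2 h2]]] := IH2 q2 r2.
  exists (p1 * p2), (b1 ==> b2); split=> [|x]; first by rewrite mulf_neq0.
  by rewrite hornerM mulf_eq0 negb_or => /andP[/h1-> /h2->].
- move=> f1 IH1 q1 r1; have [p1 [b1 [n1 h1]]] := IH1 q1 r1.
  by exists p1, (~~ b1); split=> // x /h1->.
Qed.

(** A definable subset of an algebraically closed field is finite or cofinite:
    after elimination of quantifiers it is a boolean combination of zero sets of
    polynomials in one variable. *)
Lemma formula_generic (f : GRing.formula F) : GRing.rformula f ->
  exists (p : {poly F}), p != 0 /\
    ((forall x, p.[x] != 0 -> GRing.holds [:: x] f) \/
     (forall x, p.[x] != 0 -> ~ GRing.holds [:: x] f)).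
Proof.
move=> rf; have Fc : GRing.closed_field_axiom F by exact: solve_monicpoly.
have wf := @ClosedFieldQE.wf_ex_elim F; have ok := ClosedFieldQE.holds_ex_elim Fc.
have /andP[qq rq] := GRing.quantifier_elim_wf wf rf.
have [p [b [p0 hp]]] := qf_generic qq rq.
exists p; split=> //; case: b hp => hp; [left|right] => x /hp.
  by move=> e; apply/(GRing.quantifier_elim_rformP wf ok _ rf); rewrite e.
by move=> e /(GRing.quantifier_elim_rformP wf ok _ rf); rewrite e.
Qed.

(** The unknowns [v] of a polynomial system with parameter [x]: [x] is the
    variable number 0, the unknowns follow in the order of [enum V]. *)
Definition sysenv (V : finType) (x : F) (v : V -> F) : seq F := x :: codom v.

Lemma system_generic (V J : finType) (q : J -> GRing.term F) :
  (forall j, GRing.rterm (q j)) ->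
  let solvable x := exists v : V -> F,
    forall j, GRing.eval (sysenv x v) (q j) = 0 in
  exists (p : {poly F}), p != 0 /\
    ((forall x, p.[x] != 0 -> solvable x) \/
     (forall x, p.[x] != 0 -> ~ solvable x)).
Proof.
move=> rq solvable.
pose body := \big[@GRing.And F/GRing.Bool true]_j
  GRing.Equal (q j) (GRing.Const 0).
pose f := foldr (@GRing.Exists F) body (iota 1 #|V|).
have bodyP e : GRing.holds e body <-> forall j, GRing.eval e (q j) = 0.
  rewrite /body; split.
    move=> h j; move: h; have : j \in index_enum J by exact: mem_index_enum.
    elim: (index_enum J) => // i r IH; rewrite inE big_cons /= => ji [h1 h2].
    by move: ji => /predU1P[->|/IH]; [|apply].
  move=> h; elim: (index_enum J) => [|i r IH]; first by rewrite big_nil.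
  by rewrite big_cons /=; split; first exact: h.
have rf : GRing.rformula f.
  rewrite /f; elim: (iota _ _) => //=; rewrite /body.
  apply: (big_ind (@GRing.rformula F)) => // [a b /= -> -> //|j _ /=].
  by rewrite rq.
have fP x : GRing.holds [:: x] f <-> solvable x.
  split.
    case/GRing.foldExistsP => e' same /bodyP h.
    exists (fun y => e'`_(enum_rank y).+1) => j; apply: etrans (h j).
    apply: GRing.eq_eval => -[|i] /=.
      by have := same 0%N; rewrite !inE mem_iota /= => /(_ isT) <-.
    have [iV|iV] := ltnP i #|V|.
      by rewrite (nth_codom _ _ (Ordinal iV)) enum_valK.
    rewrite nth_default ?size_codom // -same /= ?nth_nil //.
    by rewrite !inE mem_iota /= add1n ltnS ltnNge iV.
  case=> v h; apply/GRing.foldExistsP; exists (sysenv x v); last exact/bodyP.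
  move=> [|i]; rewrite !inE mem_iota //= add1n ltnS -leqNgt => iV.
  by rewrite nth_nil nth_default // size_codom.
have [p [p0 hp]] := formula_generic rf.
exists p; split=> //; case: hp => hp; [left|right] => x /hp.
  by move/fP.
by move=> h /fP.
Qed.

Lemma poly_nonroot (p : {poly F}) (f : nat -> F) N : injective f -> p != 0 ->
  exists2 m, (N <= m)%N & p.[f m] != 0.
Proof.
move=> fI p0; have us : uniq [seq f m | m <- iota N (size p)].
  by rewrite map_inj_uniq ?iota_uniq.
have := contraNN (fun x => max_poly_roots p0 x us).
rewrite size_map size_iota ltnn => /(_ isT) /allPn[a /mapP[m]].
by rewrite mem_iota => /andP[Nm _] -> rm; exists m.
Qed.

End Constructible.

Section DestabilisingSystem.
Variable F : closedFieldType.
Context {n : nat} {I : finType}.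

Local Notation tm := (GRing.term F).

Definition mulT (A B : 'I_n -> 'I_n -> tm) i j : tm :=
  \big[@GRing.Add F/GRing.Const 0]_k GRing.Mul (A i k) (B k j).

Lemma eval_mulT e A B i j : GRing.eval e (mulT A B i j) =
  \sum_k GRing.eval e (A i k) * GRing.eval e (B k j).
Proof. exact: (big_morph (GRing.eval e)). Qed.

Lemma rterm_mulT (A B : 'I_n -> 'I_n -> tm) i j :
  (forall i j, GRing.rterm (A i j)) -> (forall i j, GRing.rterm (B i j)) ->
  GRing.rterm (mulT A B i j).
Proof.
move=> rA rB; apply: (big_ind (@GRing.rterm F)) => // [a b /= -> -> //|k _ /=].
by rewrite rA rB.
Qed.

(** Unitriangularity and the vanishing of prescribed entries of the products
    [T i *m (X i *m K)], with [X i] depending linearly on a parameter, form a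
    system of polynomial equations in the entries of [K], its inverse and the
    [T i]. *)
Lemma destabilisation_generic (X0 X1 : I -> 'M[F]_n)
    (Z : I -> 'I_n -> 'I_n -> bool) :
  let D x := exists (K : 'M[F]_n) (T : I -> 'M[F]_n),
    [/\ K \in unitmx, forall i, is_trig_mx (T i) && [forall a, T i a a == 1] &
        forall i a b, Z i a b ->
          (T i *m ((X0 i + x *: X1 i) *m K)) a b = 0] in
  exists (p : {poly F}), p != 0 /\
    ((forall x, p.[x] != 0 -> D x) \/ (forall x, p.[x] != 0 -> ~ D x)).
Proof.
move=> D.
pose E := ('I_n * 'I_n)%type.
pose V : finType := ((E + E) + (I * E))%type.
pose var (v : V) : tm := GRing.Var F (enum_rank v).+1.
pose K a b := var (inl (inl (a, b))).
pose K' a b := var (inl (inr (a, b))).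
pose T i a b := var (inr (i, (a, b))).
pose X i a b : tm := GRing.Add (GRing.Const (X0 i a b))
  (GRing.Mul (GRing.Var F 0) (GRing.Const (X1 i a b))).
pose J : finType := (E + (I * E) + (I * E))%type.
(* [K'] stands for the inverse of [K]; the entries of [T i] on and above the
   diagonal are prescribed. Equations without content are [0 = 0]. *)
pose q (j : J) : tm := match j with
  | inl (inl (a, b)) =>
      GRing.Add (mulT K K' a b) (GRing.Opp (GRing.Const (a == b)%:R))
  | inl (inr (i, (a, b))) => if (a <= b)%N then
      GRing.Add (T i a b) (GRing.Opp (GRing.Const (a == b)%:R))
      else GRing.Const 0
  | inr (i, (a, b)) => if Z i a b then mulT (T i) (mulT (X i) K) a b
      else GRing.Const 0
  end.
have rq j : GRing.rterm (q j).
  case: j => [[[a b]|[i [a b]]]|[i [a b]]] /=.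
  - by rewrite rterm_mulT.
  - by case: ifP.
  - case: ifP => // _; apply: rterm_mulT => // c d.
    by apply: rterm_mulT.
have [p [p0 hp]] := @system_generic F V J q rq.
have evar x (v : V -> F) y : GRing.eval (sysenv x v) (var y) = v y.
  by rewrite /= (nth_codom _ _ (enum_rank y)) enum_rankK.
suff eqv x : (exists v : V -> F, forall j, GRing.eval (sysenv x v) (q j) = 0)
    <-> D x.
  exists p; split=> //; case: hp => hp; [left|right] => x /hp.
    by move/eqv.
  by move=> h /eqv.
split.
  case=> v h.
  pose KM : 'M[F]_n := \matrix_(a, b) v (inl (inl (a, b))).
  pose KM' : 'M[F]_n := \matrix_(a, b) v (inl (inr (a, b))).
  pose TM i : 'M[F]_n := \matrix_(a, b) v (inr (i, (a, b))).
  exists KM, TM; split.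
  - suff KK : KM *m KM' = 1%:M by have [] := mulmx1_unit KK.
    apply/matrixP => a b; rewrite !mxE.
    have := h (inl (inl (a, b))); rewrite /= eval_mulT => /eqP.
    rewrite subr_eq0 => /eqP <-; apply: eq_bigr => c _.
    by rewrite !evar !mxE.
  - move=> i; have hT (a b : 'I_n) : (a <= b)%N -> TM i a b = (a == b)%:R.
      move=> ab.
      have /eqP : GRing.eval (sysenv x v) (T i a b) - (a == b)%:R = 0.
        by have := h (inl (inr (i, (a, b)))); rewrite /q ab.
      by rewrite evar subr_eq0 mxE => /eqP.
    apply/andP; split; last by apply/forallP => a; rewrite hT ?eqxx.
    apply/is_trig_mxP => a b ab; rewrite hT ?(ltnW ab) //.
    by rewrite -val_eqE (ltn_eqF ab).
  - move=> i a b z; have := h (inr (i, (a, b))).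
    rewrite /q z eval_mulT => e0; apply: etrans e0.
    rewrite !mxE; apply: eq_bigr => c _; rewrite evar !mxE; congr (_ * _).
    rewrite eval_mulT; apply: eq_bigr => d _; rewrite evar !mxE.
    by congr (_ * _).
case=> KM [TM [Ku Tu Ts]].
pose v (y : V) : F := match y with
  | inl (inl (a, b)) => KM a b
  | inl (inr (a, b)) => invmx KM a b
  | inr (i, (a, b)) => TM i a b
  end.
exists v => -[[[a b]|[i [a b]]]|[i [a b]]].
- rewrite /= eval_mulT; apply/eqP; rewrite subr_eq0; apply/eqP.
  have /matrixP/(_ a b) := mulmxV Ku; rewrite !mxE => <-.
  by apply: eq_bigr => c _; rewrite !evar.
- rewrite /q; case: ifP => // ab.
  have -> : GRing.eval (sysenv x v) (GRing.Add (T i a b)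
      (GRing.Opp (GRing.Const (a == b)%:R))) =
      GRing.eval (sysenv x v) (T i a b) - (a == b)%:R by [].
  rewrite evar /=; have /andP[/is_trig_mxP Tt /forallP T1] := Tu i.
  have [->|nab] := eqVneq a b; first by rewrite (eqP (T1 b)) subrr.
  by rewrite Tt ?subr0 // ltn_neqAle nab.
- rewrite /q; case: ifP => // z; rewrite eval_mulT -[RHS](Ts i a b z) !mxE.
  apply: eq_bigr => c _; rewrite evar; congr (_ * _).
  rewrite eval_mulT !mxE; apply: eq_bigr => d _; rewrite evar !mxE.
  by congr (_ * _).
Qed.

End DestabilisingSystem.

(** * Negative slopes and the size of the moment *)

Section Destabilisation.
Context {R : realType}.
Local Notation C := (cplx R).
Context {n : nat} {I : finType} (X : I -> 'M[C]_n) (w : I -> nat -> R).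
Hypothesis X_unit : forall i, X i \in unitmx.
Hypothesis w_last : forall i, w i n = 0.
Hypothesis w_decr : forall i k, (k.+1 < n)%N -> w i k.+1 <= w i k.
Hypothesis n_gt0 : (0 < n)%N.

Lemma lognorm_growth (K : 'M[C]_n) (l : 'I_n -> R) s : K \in unitmx -> 0 <= s ->
  lognorm (K *m rdiag (fun j => expR (s * l j)))
    <= 2 * s * norm1 l + lognorm K.
Proof.
move=> Ku s0; set E := rdiag _.
have E0 j : expR (s * l j) != 0 by rewrite gt_eqF ?expR_gt0.
have Eu : E \in unitmx by exact: rdiag_unit.
have KEu : K *m E \in unitmx by rewrite unitmx_mul Ku Eu.
set y := expR (2 * s * norm1 l).
have le j : (expR (s * l j)) ^+ 2 <= y /\ (expR (s * l j))^-1 ^+ 2 <= y.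
  have h := norm1_ge l j; split.
    rewrite -expRM_natl ler_expR -mulrA ler_pM2l //; apply: ler_wpM2l => //.
    exact: le_trans (ler_norm _) h.
  rewrite -expRN -expRM_natl ler_expR -[leRHS]mulrA ler_pM2l // -mulrN.
  apply: ler_wpM2l => //; apply: le_trans h.
  by rewrite -normrN ler_norm.
have le1 : frob2 (K *m E) <= y * frob2 K.
  by apply: frob2_mulr_rdiag_le => j; have [] := le j.
have le2 : frob2 (invmx (K *m E)) <= y * frob2 (invmx K).
  have -> : invmx (K *m E) = rdiag (fun j => (expR (s * l j))^-1) *m invmx K.
    apply: (can_inj (mulKmx KEu)); rewrite (mulmxV KEu) mulmxA -(mulmxA K).
    rewrite rdiagM (_ : (fun j => _ * _) = fun=> 1).
      by rewrite rdiag1 mulmx1; exact/esym/mulmxV.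
    by apply/funext => j; rewrite mulfV.
  rewrite -frob2_adj adjmxM adj_rdiag -(frob2_adj (invmx K)).
  by apply: frob2_mulr_rdiag_le => j; have [] := le j.
have K0 : 0 < frob2 K + frob2 (invmx K).
  by rewrite ltr_pwDl ?frob2_ge0 // frob2_unit_gt0.
have KE0 : 0 < frob2 (K *m E) + frob2 (invmx (K *m E)).
  by rewrite ltr_pwDl ?frob2_ge0 // frob2_unit_gt0.
rewrite addrC; apply: ln_le_add => //.
by rewrite -/y mulrC mulrDr; exact: lerD.
Qed.

Lemma ge0_of_linear_bound (a b : R) :
  (forall s, 0 <= s -> a <= s * b) -> 0 <= b.
Proof.
move=> h; rewrite leNgt; apply/negP => b0.
have nb : 0 < - b by rewrite oppr_gt0.
have s0 : 0 <= (`|a| + 1) / - b by rewrite divr_ge0 ?(ltW nb) ?addr_ge0.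
have := h _ s0; rewrite invrN mulrN mulNr -mulrA mulVf ?lt_eqF // mulr1.
by have := ler_norm (- a); rewrite normrN; lra.
Qed.

(** A destabilising direction keeps the moment of [1] away from zero: along it
    the Kempf-Ness function decreases at least at the rate given by the slope,
    whereas by convexity the rate is controlled by the gradient at [1]. *)
Lemma slope_ge_moment (K : 'M[C]_n) (T : I -> 'M[C]_n) (p : I -> 'S_n)
    (l : 'I_n -> R) (eta : R) :
  K \in unitmx -> (forall i, unitrig (T i)) ->
  (forall i k j, (T i *m (X i *m K)) k j != 0 -> l j <= l (p i k)) ->
  0 < eta ->
  - (n%:R * norm1 l * (frob2 (moment X w 1%:M) / eta + eta * n%:R))
    <= 2 * slope w p l.
Proof.
move=> Ku Tu supp eta0.
have [c hc] := kn_growth_le X_unit w_last w_decr Ku Tu supp.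
set G := frob2 _ / eta + _; set N := norm1 l.
have G0 : 0 <= G.
  apply: addr_ge0; first by rewrite divr_ge0 ?frob2_ge0 // ltW.
  by rewrite mulr_ge0 ?ler0n // ltW.
rewrite -subr_ge0 opprK -(pmulr_rge0 _ (ltr0n R 2 : 0 < 2)).
apply: (@ge0_of_linear_bound (2 * kempf_ness X w 1%:M - n%:R * lognorm K * G - 2 * c)).
move=> s s0; set E := rdiag (fun j => expR (s * l j)).
have Eu : E \in unitmx by apply: rdiag_unit => j; rewrite gt_eqF ?expR_gt0.
have KEu : K *m E \in unitmx by rewrite unitmx_mul Ku Eu.
have [U [m [Uu eg]]] := unitary_polar KEu.
have lo := kn_ge_near_balanced X_unit w_decr Uu eta0 (norm1_ge m).
rewrite -/G in lo.
have e : kempf_ness X w (U^t* *m rdiag (fun j => expR (m j))) = kempf_ness X w (K *m E).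
  apply: kn_eq_of_gram; rewrite eg adjmxM adjmxK adj_rdiag !mulmxA.
  rewrite -(mulmxA (U^t*)) rdiagM.
  rewrite (_ : (fun j => _ * _) = (fun j => expR (2 * m j))) //.
  by apply/funext => j; rewrite -expRD mulr_natl mulr2n.
rewrite e in lo.
have up := hc s s0; rewrite -/E in up.
have b1 := norm1_le_lognorm KEu Uu eg.
have b2 := lognorm_growth l Ku s0; rewrite -/E -/N in b2.
move: (kempf_ness X w (K *m E)) (kempf_ness X w 1%:M) (norm1 m) (lognorm (K *m E)) lo up b1 b2.
move: (lognorm K) (slope w p l) => LK sl k1 k0 nm L lo up b1 b2.
have b3 : 2 * nm <= n%:R * (2 * s * N + LK).
  by apply: (le_trans b1); rewrite ler_wpM2l ?ler0n.
have b4 := ler_wpM2r G0 b3.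
have -> : s * (2 * (2 * sl + n%:R * N * G)) =
  4 * s * sl + n%:R * (2 * s * N + LK) * G - n%:R * LK * G by ring.
have -> : 4 * s * sl = 2 * (2 * s * sl) by ring.
have b5 : 2 * (nm * G) <= n%:R * (2 * s * N + LK) * G by rewrite mulrA.
clear - lo up b5; lra.
Qed.

End Destabilisation.

(** * From complex to real flags *)

Lemma horner_det_pencil (F : comNzRingType) n (A B : 'M[F]_n) z :
  (\det (map_mx polyC A + 'X *: map_mx polyC B)).[z] = \det (A + z *: B).
Proof.
rewrite -horner_evalE -det_map_mx map_mxD map_mxZ /= horner_evalE hornerX.
by rewrite -!map_mx_comp !map_mx_id // => a; exact: hornerC.
Qed.

Section HermitianToReal.
Context {R : realType}.
Local Notation C := (cplx R).
Context {n : nat} {I : finType} (U : I -> 'M[C]_n) (w : I -> nat -> R).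
Hypothesis U_unitary : forall i, U i \is unitarymx.
Hypothesis w_last : forall i, w i n = 0.
Hypothesis w_decr : forall i k, (k.+1 < n)%N -> w i k.+1 <= w i k.
Hypothesis n_gt0 : (0 < n)%N.
Hypothesis sum0 : \sum_i with_spectrum (U i) (w i) = 0.

(** The pencil [X z], equal to [U] at ['i] and real for real [z]. *)
Let X0 i : 'M[C]_n := map_mx (fun z => toC (re z)) (U i).
Let X1 i : 'M[C]_n := map_mx (fun z => toC (im z)) (U i).
Let X (z : C) i : 'M[C]_n := X0 i + z *: X1 i.

Let X_i i : X 'i i = U i.
Proof.
by apply/matrixP => a b; rewrite !mxE toC_im toC_re -Crect.
Qed.

Let X_real (x : R) i : isreal (X (toC x) i).
Proof.
by apply/matrixP => a b; rewrite !mxE rmorphD rmorphM /= !conj_toC.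
Qed.

Let detX : {poly C} :=
  \prod_i \det (map_mx polyC (X0 i) + 'X *: map_mx polyC (X1 i)).

Let X_unit z : detX.[z] != 0 -> forall i, X z i \in unitmx.
Proof.
rewrite /detX horner_prod => /prodf_neq0 h i; have := h i isT.
by rewrite horner_det_pencil unitmxE unitfE.
Qed.

Let detX_neq0 : detX != 0.
Proof.
suff : detX.['i] != 0 by apply: contra_neq => ->; rewrite horner0.
rewrite /detX horner_prod; apply/prodf_neq0 => i _.
rewrite horner_det_pencil -/(X 'i i) X_i -unitfE -unitmxE.
exact: unitarymx_unit.
Qed.

(** The shape of a destabilising flag: the order on the indices induced by [l],
    and the positions of the pivots. *)
Let shape : finType :=
  ({ffun 'I_n * 'I_n -> bool} * {ffun I -> 'S_n})%type.

Let has_shape (t : shape) (z : C) := exists (K : 'M[C]_n) (T : I -> 'M[C]_n),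
  [/\ K \in unitmx, forall i, unitrig (T i) &
      forall i a b, ~~ t.1 (b, t.2 i a) -> (T i *m (X z i *m K)) a b = 0].

(** Whether a shape destabilises depends on the shape alone. *)
Let bad (t : shape) := exists2 l : 'I_n -> R,
  (forall a b, t.1 (a, b) -> l a <= l b) & slope w t.2 l < 0.

Let approach (m : nat) : C := 'i + toC m.+1%:R^-1.

Let approach_inj : injective approach.
Proof.
move=> a b /addrI/toC_inj/invr_inj/eqP; rewrite eqr_nat => /eqP.
by move=> [].
Qed.

Let approach_cvg (f : nat -> nat) : (forall k, k <= f k)%N ->
  cvC (fun k => approach (f k)) 'i.
Proof.
move=> kf; rewrite -[X in cvC _ X]addr0; apply: cvCD; first exact: cvC_cst.
rewrite -(rmorph0 toC); apply: cvC_toC.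
apply: (@tends_sub _ (fun k => k.+1%:R^-1) 0 f kf).
apply/tendsP => e e0.
have [N hN] : exists N : nat, e^-1 < N%:R.
  by eexists; exact: Num.Theory.truncnS_gt.
exists N => k Nk; rewrite sub0r normrN ger0_norm ?invr_ge0 ?ler0n //.
rewrite -[ltRHS]invrK ltf_pV2 ?posrE ?invr_gt0 ?ltr0n //.
by apply: (lt_le_trans hN); rewrite ler_nat (leq_trans Nk).
Qed.

Let moment_limit (y : nat -> C) : (forall k i, X (y k) i \in unitmx) ->
  cvC y 'i -> tends (fun k => frob2 (moment (X (y k)) w 1%:M)) 0.
Proof.
move=> Xu yi.
have -> : 0 = frob2 (\sum_i with_spectrum (U i) (w i)).
  rewrite sum0 /frob2 big1 // => a _; rewrite big1 // => b _.
  by rewrite mxE; apply/eqP; rewrite sqn_eq0.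
apply: tends_frob2; apply: cvMx_sum => i.
have -> : with_spectrum (U i) (w i) = flagmx (X 'i i) (w i).
  by rewrite X_i (flagmx_unitary (U_unitary i) (w_last i)).
apply: cvMx_flagmx => [k||].
- by rewrite mulmx1.
- by rewrite X_i unitarymx_unit.
under eq_fun do rewrite mulmx1.
apply: cvMxD; first exact: cvMx_cst.
by apply: cvMxZ => //; exact: cvMx_cst.
Qed.

(** If a destabilising shape occurred for all but finitely many parameters, it
    would occur arbitrarily close to ['i], where the moment tends to 0; by
    [slope_ge_moment] its slope would not be negative. *)
Let bad_exceptional t : bad t -> exists2 p : {poly C}, p != 0 &
  forall z, p.[z] != 0 -> ~ has_shape t z.
Proof.
move=> [l tl sl].
have [p [p0 hp]] := destabilisation_generic X0 X1
  (fun i a b => ~~ t.1 (b, t.2 i a)).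
exists p => //; case: hp => // hp; exfalso.
have /choice[f hf] : forall N, exists m, (N <= m)%N /\
    (p * detX).[approach m] != 0.
  move=> N; have [||m Nm pm] := @poly_nonroot _ (p * detX) approach N.
  - exact: approach_inj.
  - by rewrite mulf_neq0.
  by exists m.
have pf k : p.[approach (f k)] != 0.
  by have [_] := hf k; rewrite hornerM mulf_eq0 negb_or => /andP[].
have Xu k i : X (approach (f k)) i \in unitmx.
  by apply: X_unit; have [_] := hf k; rewrite hornerM mulf_eq0 negb_or => /andP[].
have F0 := moment_limit Xu (approach_cvg (fun k => (hf k).1)).
pose Fk k := frob2 (moment (X (approach (f k))) w 1%:M).
have bound k eta : 0 < eta ->
    - (n%:R * norm1 l * (Fk k / eta + eta * n%:R)) <= 2 * slope w t.2 l.
  move=> eta0; have [K [T [Ku Tu supp]]] := hp _ (pf k).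
  apply: (slope_ge_moment (Xu k) w_last w_decr n_gt0 Ku Tu _ eta0).
  move=> i a b; apply: contraNT; rewrite -ltNge => lt.
  apply/eqP; apply: supp; apply/negP => /tl.
  by rewrite leNgt lt.
pose M := n%:R * norm1 l * n%:R.
have M0 : 0 <= M by rewrite !mulr_ge0 ?ler0n ?norm1_ge0.
have lim eta : 0 < eta -> - (M * eta) <= 2 * slope w t.2 l.
  move=> eta0; pose x k := - (n%:R * norm1 l * (Fk k / eta + eta * n%:R)).
  have xl : tends x (- (n%:R * norm1 l * (0 / eta + eta * n%:R))).
    apply: tendsN; apply: tendsM; first exact: tends_cst.
    apply: tendsD; last exact: tends_cst.
    by apply: tendsM => //; exact: tends_cst.
  have := tends_le xl (ex_intro _ 0%N (fun k _ => bound k eta eta0)).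
  by rewrite mul0r add0r /M; congr (- _ <= _); ring.
have eta0 : 0 < - slope w t.2 l / (M + 1).
  by rewrite divr_gt0 ?oppr_gt0 //; lra.
have := lim _ eta0; rewrite mulrA.
have -> : M * - slope w t.2 l / (M + 1)
    = - slope w t.2 l + slope w t.2 l / (M + 1) by field; lra.
have : slope w t.2 l / (M + 1) < 0.
  by rewrite pmulr_llt0 ?invr_gt0 //; lra.
move: (slope w t.2 l) (slope w t.2 l / _) sl => a b; lra.
Qed.

(** Some integer [m] avoids the finitely many parameters for which [X m] is
    singular or has a destabilising shape. *)
Theorem hermitian_to_real : exists Q : I -> 'M[C]_n,
  [/\ forall i, Q i \is unitarymx,
      forall i, isreal (with_spectrum (Q i) (w i)) &
      \sum_i with_spectrum (Q i) (w i) = 0].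
Proof.
have /choice[p hp] : forall t : shape, exists p : {poly C}, p != 0 /\
    (bad t -> forall z, p.[z] != 0 -> ~ has_shape t z).
  move=> t; have [/bad_exceptional[p p0 hp]|nb] := pselect (bad t).
    by exists p.
  by exists 1; split=> //; exact: oner_neq0.
have [||m _ pm] := @poly_nonroot _ (\prod_t p t * detX)
    (fun m => toC m%:R) 0.
- by move=> a b /toC_inj/eqP; rewrite eqr_nat => /eqP.
- rewrite mulf_neq0 //; apply/prodf_neq0 => t _; exact: (hp t).1.
move: pm; rewrite hornerM mulf_eq0 negb_or => /andP[pm dm].
have pt t : (p t).[toC m%:R] != 0.
  by move: pm; rewrite horner_prod => /prodf_neq0; apply.
apply: (semistable_real_balanced (X_unit dm) w_last w_decr n_gt0) => //.
move=> K T q l Ku Tu supp; rewrite leNgt; apply/negP => sl.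
pose t : shape := ([ffun ab => l ab.1 <= l ab.2], [ffun i => q i]).
apply: ((hp t).2 _ _ (pt t)).
  exists l => [a b|]; first by rewrite ffunE.
  suff -> : slope w t.2 l = slope w q l by [].
  by apply: eq_bigr => i _; apply: eq_bigr => k _; rewrite ffunE.
exists K, T; split=> // i a b; rewrite !ffunE /= => nle.
by apply/eqP; apply: contraNT nle; exact: supp.
Qed.

End HermitianToReal.

(** * Matrices with prescribed eigenvalues *)

Section Spectra.
Context {R : realType}.
Local Notation C := (cplx R).

Lemma char_poly_unitary_congr n (Q : 'M[C]_n) (d : 'I_n -> R) :
  Q \is unitarymx ->
  char_poly (Q^t* *m rdiag d *m Q) = \prod_i ('X - (toC (d i))%:P).
Proof.
move=> Qu; have QQ := unitary_adjK Qu.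
transitivity (char_poly (rdiag d)); last first.
  rewrite char_poly_trig.
    by apply: eq_bigr => i _; rewrite !mxE eqxx mulr1n.
  by apply/is_trig_mxP => i j ij; rewrite !mxE -val_eqE (ltn_eqF ij) mulr0n.
rewrite /char_poly /char_poly_mx.
have PP : map_mx polyC (Q^t*) *m map_mx polyC Q = 1%:M.
  by rewrite -map_mxM QQ map_mx1.
have -> : 'X%:M - map_mx polyC (Q^t* *m rdiag d *m Q) =
    map_mx polyC (Q^t*) *m ('X%:M - map_mx polyC (rdiag d)) *m map_mx polyC Q.
  rewrite mulmxBr mulmxBl !map_mxM; congr (_ - _).
  by rewrite mul_mx_scalar -scalemxAl PP scalemx1.
by rewrite !det_mulmx mulrAC -det_mulmx PP det1 mul1r.
Qed.

Lemma rdiag_perm n (Q : 'M[C]_n) (d : 'I_n -> R) (s : 'S_n) : Q \is unitarymx ->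
  exists2 Q', Q' \is unitarymx &
    Q^t* *m rdiag d *m Q = Q'^t* *m rdiag (fun i => d (s i)) *m Q'.
Proof.
move=> Qu; pose P : 'M[C]_n := perm_mx s.
have Padj : P^t* = (perm_mx s)^T.
  by apply/matrixP => i j; rewrite !mxE; case: eqP; rewrite ?rmorph1 ?rmorph0.
have PP : P^t* *m P = 1%:M by rewrite Padj tr_perm_mx -perm_mxM mulVg perm_mx1.
have Pu : P \is unitarymx by apply/unitarymxP; exact: mulmx1C.
exists (P *m Q); first exact: mul_unitarymx.
have -> : rdiag (fun i => d (s i)) = P *m rdiag d *m P^t*.
  apply/matrixP => i j; rewrite !mxE (bigD1 (s j)) //= big1 ?addr0.
    rewrite Padj mul_mx_diag !mxE eqxx mulr1.
    by rewrite (inj_eq perm_inj); case: eqP => [->|];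
      rewrite ?mul1r ?mul0r ?mulr0n ?mulr1n.
  by move=> k ks; rewrite Padj !mxE eq_sym (negPf ks) mulr0.
rewrite adjmxM !mulmxA -(mulmxA _ (P^t*) P) PP mulmx1.
by rewrite -(mulmxA _ (P^t*) P) PP mulmx1.
Qed.

(** The spectral theorem gives the eigenvalues in some order; any other order is
    obtained by permuting the eigenvectors. *)
Lemma hermitian_with_spectrum n (H : 'M[C]_n) (a : n.-tuple R) : H^t* = H ->
  char_poly H = \prod_(x <- a) ('X - (toC x)%:P) ->
  exists2 U, U \is unitarymx & H = with_spectrum U (nth 0 a).
Proof.
move=> Hh cH; have [U [d [Uu eH]]] := hermitian_diag Hh.
have : perm_eq [seq toC x | x <- a] [seq toC x | x <- [tuple d i | i < n]].
  apply: prod_XsubC_eq; rewrite (big_map toC xpredT (fun x => 'X - x%:P)).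
  rewrite (big_map toC xpredT (fun x => 'X - x%:P)) -cH eH.
  rewrite char_poly_unitary_congr // big_tuple.
  by apply: eq_bigr => i _; rewrite tnth_mktuple.
move=> /(perm_map_inj toC_inj); rewrite perm_sym => /tuple_permP[s' es'].
have [s es] : exists s : 'S_n, forall i : 'I_n, nth 0 a i = d (s i).
  exists s'^-1%g => i.
  have : nth 0 [tuple d i | i < n] ((s'^-1)%g i) = tnth a i.
    by rewrite es' -tnth_nth tnth_mktuple permKV.
  by rewrite -tnth_nth tnth_mktuple (tnth_nth 0) => ->.
have [Q Qu eQ] := rdiag_perm d s Uu.
exists Q => //; rewrite eH eQ /with_spectrum; congr (_ *m rdiag _ *m _).
by apply/funext => i; rewrite es.
Qed.

Lemma real_part_matrix n (S : 'M[C]_n) : isreal S ->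
  map_mx toC (map_mx re S) = S.
Proof.
move=> Sr; apply/matrixP => i j; rewrite !mxE toC_re.
by apply/Creal_ReP/CrealP; rewrite -[in RHS]Sr mxE.
Qed.

Lemma symmetric_of_real_spectrum n (Q : 'M[C]_n) (w : nat -> R)
    (a : n.-tuple R) :
  Q \is unitarymx -> isreal (with_spectrum Q w) ->
  (forall i : 'I_n, w i = nth 0 a i) ->
  let A : 'M[R]_n := map_mx re (with_spectrum Q w) in
  A \is symmetricmx /\ eigenvalue_list A a.
Proof.
move=> Qu Sr wa A; have eA : map_mx toC A = with_spectrum Q w.
  exact: real_part_matrix.
split.
  apply/is_hermitianmxP; rewrite expr0 scale1r map_mx_id //.
  apply: (@map_mx_inj _ _ toC); rewrite -map_trmx eA.
  have Sh : (with_spectrum Q w)^t* = with_spectrum Q w.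
    by rewrite /with_spectrum !adjmxM adjmxK adj_rdiag mulmxA.
  by rewrite -[in LHS]Sh -map_trmx Sr.
apply: (@map_poly_inj _ _ toC); rewrite map_char_poly eA.
rewrite char_poly_unitary_congr // rmorph_prod /=.
rewrite (big_nth 0) size_tuple big_mkord; apply: eq_bigr => i _.
by rewrite rmorphB /= map_polyX map_polyC /= wa.
Qed.

End Spectra.

(** * The sum of two Hermitian matrices *)

Section Transfer.
Context {R : realType} {n : nat}.
Hypothesis n_gt0 : (0 < n)%N.
Local Notation C := (cplx R).

Lemma sorted_step (a : n.-tuple R) k :
  sorted >=%R a -> (k.+1 < n)%N -> nth 0 a k.+1 <= nth 0 a k.
Proof.
move=> sa kn1; apply: (sorted_ltn_nth _ 0 sa); rewrite ?inE ?size_tuple //.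
  by move=> x y z yx zy; exact: le_trans zy yx.
exact: ltnW.
Qed.

(** The eigenvalues of [- H] in decreasing order, for those of [H]. *)
Definition opp_rev (c : n.-tuple R) := [tuple - nth 0 c (rev_ord i) | i < n].

Lemma opp_rev_sorted (c : n.-tuple R) : sorted >=%R c ->
  forall k, (k.+1 < n)%N -> nth 0 (opp_rev c) k.+1 <= nth 0 (opp_rev c) k.
Proof.
move=> sc k kn1; have kn0 := ltnW kn1.
rewrite -[k.+1]/(nat_of_ord (Ordinal kn1)) -[X in _ <= nth 0 _ X]/(nat_of_ord (Ordinal kn0)).
rewrite -!tnth_nth !tnth_mktuple lerN2 /= -(subnSK kn1).
by apply: sorted_step; rewrite // subnSK // ltn_subrL n_gt0.
Qed.

(** The matrices [A], [B] and [- (A + B)] sum to 0; the index type [option bool]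
    has one element for each of them, [None] for the last. *)
Theorem real_spectra_of_hermitian (a b c : n.-tuple R) (A B : 'M[C]_n) :
  sorted >=%R a -> sorted >=%R b -> sorted >=%R c ->
  A^t* = A -> B^t* = B ->
  char_poly A = \prod_(x <- a) ('X - (toC x)%:P) ->
  char_poly B = \prod_(x <- b) ('X - (toC x)%:P) ->
  char_poly (A + B) = \prod_(x <- c) ('X - (toC x)%:P) ->
  exists S T : 'M[R]_n,
    [/\ S \is symmetricmx, T \is symmetricmx & S + T \is symmetricmx] /\
    [/\ eigenvalue_list S a, eigenvalue_list T b & eigenvalue_list (S + T) c].
Proof.
move=> sa sb sc Ah Bh cA cB cAB.
have [U Uu eA] := hermitian_with_spectrum Ah cA.
have [V Vu eB] := hermitian_with_spectrum Bh cB.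
have ABh : (A + B)^t* = A + B by rewrite adjmxD Ah Bh.
have [W0 W0u eAB] := hermitian_with_spectrum ABh cAB.
have oppws (Q : 'M[C]_n) (f : 'I_n -> R) :
    - (Q^t* *m rdiag f *m Q) = Q^t* *m rdiag (fun i => - f i) *m Q.
  rewrite -mulNmx -mulmxN; congr (_ *m _ *m _).
  rewrite -scaleN1r -(rmorph1 toC) -rmorphN -rdiagZ.
  by apply: eq_rdiag => i; rewrite mulN1r.
pose rho : 'S_n := perm (@rev_ord_inj n).
have [W Wu eW] := rdiag_perm (fun i : 'I_n => - nth 0 c i) rho W0u.
have ecW : - (A + B) = with_spectrum W (nth 0 (opp_rev c)).
  rewrite eAB oppws eW; congr (_ *m _ *m _); apply: eq_rdiag => i.
  by rewrite -(tnth_nth 0 (opp_rev c) i) tnth_mktuple permE.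
pose w (i : option bool) := nth 0 (match i with
  | None => opp_rev c | Some true => a | Some false => b end).
pose Q0 (i : option bool) := match i with
  | None => W | Some true => U | Some false => V end.
have sum3 (F : option bool -> 'M[C]_n) :
    \sum_i F i = F None + (F (Some true) + F (Some false)).
  rewrite (bigD1 None) //= (bigD1 (Some true)) //= (bigD1 (Some false)) //=.
  by rewrite big1 ?addr0 // => -[[]|].
have [| | | | |Q [Qu Qr Qs]] := @hermitian_to_real R n _ Q0 w.
- by move=> [[]|]; [exact: Uu|exact: Vu|exact: Wu].
- by case=> [[]|]; rewrite /w nth_default // size_tuple.
- by case=> [[]|] k kn1; [exact: sorted_step|exact: sorted_step|exact: opp_rev_sorted].
- exact: n_gt0.
- by rewrite sum3 /= -ecW -eA -eB addNr.
have eC : with_spectrum (Q (Some true)) (w (Some true)) +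
    with_spectrum (Q (Some false)) (w (Some false)) =
    - with_spectrum (Q None) (w None).
  by move: Qs; rewrite sum3 addrC => /eqP; rewrite addr_eq0 => /eqP.
have [Z Zu eZ] := rdiag_perm (fun i : 'I_n => - w None i) rho (Qu None).
have ecZ : - with_spectrum (Q None) (w None) = with_spectrum Z (nth 0 c).
  rewrite oppws eZ; congr (_ *m _ *m _); apply: eq_rdiag => i.
  by rewrite permE /w /= -(tnth_nth 0 (opp_rev c) (rev_ord i)) tnth_mktuple opprK rev_ordK.
have Zr : isreal (with_spectrum Z (nth 0 c)).
  rewrite -ecZ /isreal raddfN; congr (- _); exact: Qr.
have [Ss Se] := @symmetric_of_real_spectrum R n _ _ a (Qu (Some true))
  (Qr (Some true)) (fun=> erefl).
have [Ts Te] := @symmetric_of_real_spectrum R n _ _ b (Qu (Some false))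
  (Qr (Some false)) (fun=> erefl).
have [STs STe] := @symmetric_of_real_spectrum R n _ _ c Zu Zr (fun=> erefl).
move: STs STe; rewrite -ecZ -eC raddfD => STs STe.
by exists (map_mx re (with_spectrum (Q (Some true)) (w (Some true)))),
  (map_mx re (with_spectrum (Q (Some false)) (w (Some false)))).
Qed.

End Transfer.

(** * Real and complex realisations *)

Section Complexify.
Context {R : realType} {n : nat}.
Local Notation C := (cplx R).

Lemma map_toC_symmetric (S : 'M[R]_n) : S \is symmetricmx ->
  (map_mx toC S)^t* = map_mx toC S.
Proof.
move=> /is_hermitianmxP; rewrite expr0 scale1r map_mx_id // => eS.
apply/matrixP => i j; rewrite [in RHS]eS !mxE; exact: conj_toC.
Qed.

Lemma map_toC_eigenvalue_list (S : 'M[R]_n) (s : seq R) :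
  eigenvalue_list S s -> eigenvalue_list (map_mx toC S) [seq toC x | x <- s].
Proof.
rewrite /eigenvalue_list -map_char_poly => ->.
rewrite rmorph_prod big_map; apply: eq_bigr => x _.
by rewrite rmorphB /= map_polyX map_polyC.
Qed.

End Complexify.

(* From here on [cplx R] has to unfold to [R[i]]. *)
Transparent cplx.
Local Open Scope complex_scope.

Theorem theorem3 (R : realType) (n : nat) (alpha beta gamma : n.-tuple R)
    (n_gt0 : (0 < n)%N)
    (alpha_decr : sorted >=%R alpha) (beta_decr : sorted >=%R beta)
    (gamma_decr : sorted >=%R gamma) :
  (exists A B C : 'M[R]_n,
      [/\ A \is symmetricmx, B \is symmetricmx & C \is symmetricmx] /\
      C = A + B /\
      [/\ eigenvalue_list A alpha, eigenvalue_list B beta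
        & eigenvalue_list C gamma])
  <->
  (exists A' B' C' : 'M[R[i]]_n,
      [/\ A' \is hermsymmx, B' \is hermsymmx & C' \is hermsymmx] /\
      C' = A' + B' /\
      [/\ eigenvalue_list A' [seq x%:C | x <- alpha],
          eigenvalue_list B' [seq x%:C | x <- beta]
        & eigenvalue_list C' [seq x%:C | x <- gamma]]).
Proof.
have hermE (H : 'M[R[i]]_n) : H \is hermsymmx <-> (H : 'M[cplx R]_n)^t* = H.
  split=> [/is_hermitianmxP|eH]; first by rewrite expr0 scale1r => <-.
  by apply/is_hermitianmxP; rewrite expr0 scale1r -[LHS]eH.
split=> [[A [B [C [[As Bs Cs] [CAB [eA eB eC]]]]]]|
         [A [B [C [[Ah Bh Ch] [CAB [eA eB eC]]]]]]].
  exists (map_mx toC A), (map_mx toC B), (map_mx toC C).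
  split; first by split; apply/hermE; apply: map_toC_symmetric.
  split; first by rewrite CAB; exact: map_mxD.
  by split; apply: map_toC_eigenvalue_list.
have eT (H : 'M[R[i]]_n) (s : seq R) : eigenvalue_list H [seq x%:C | x <- s] ->
    char_poly (H : 'M[cplx R]_n) = \prod_(x <- s) ('X - (toC x)%:P).
  by move=> eH; rewrite -(big_map toC xpredT (fun x => 'X - x%:P)).
move: eC; rewrite CAB => eC.
have [S [T [[Ss Ts STs] [eS eT' eST]]]] := real_spectra_of_hermitian n_gt0
  alpha_decr beta_decr gamma_decr ((hermE _).1 Ah) ((hermE _).1 Bh)
  (eT _ _ eA) (eT _ _ eB) (eT _ _ eC).
by exists S, T, (S + T).
Qed.
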